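(* Let $m_0$ and $m$ be natural numbers with $m\ge m_0$, and let $f\in C^{2m-}$. Suppose that $f^{(2m_0-1)}(x)\to0$ as $x\to\infty$ and that the series $\sum_{k=0}^\infty f^{(2m)}(k+w)$ converges uniformly in $w\in[-m/2,m/2]$. Let $F$ be any antiderivative of $f$. Then for any natural $c$ $$\sum_{k\ge0}^{\mathrm{Alt}}f(k)=\sum_{k=0}^{c-1}f(k)-G_{m,F}(c)-R_{m,f_c}(\infty).$$
   Context: For a natural number $\alpha$, $C^{\alpha-}$ denotes the set of all functions $f:\mathbb R\to\mathbb R$ having continuous derivatives $f^{(i)}$ of all orders $i=0,\dots,\alpha-1$ and such that $f^{(\alpha-1)}$ is absolutely continuous, with a Radon–Nikodym derivative denoted by $f^{(\alpha)}$. For a function $h:\mathbb R\to\mathbb R$ and real $c$, $h_c(x):=h(x+c)$ for all real $x$. For natural $m$, $$\gamma_{m,j}:=(-1)^{j-1}\,\frac2j\,\binom{2m}{m+j}\Big/\binom{2m}{m},\qquad G_{m,F}(n):=\sum_{j=1}^m\gamma_{m,j}\sum_{i=0}^{j-1}F(n-1+j/2-i),$$ $$R_{m,f}(\infty):=\frac1{(2m-1)!\,2^{2m+1}}\int_0^1 ds\,(1-s)^{2m-1}\int_{-1}^{1}dv\,v^{2m}\sum_{j=1}^m\gamma_{m,j}\,j^{2m+1}\sum_{k=0}^{\infty}f^{(2m)}(k+jsv/2),$$ and $$\sum_{k\ge0}^{\mathrm{Alt}}f(k):=\lim_{n\to\infty}\Big(\sum_{k=0}^{n-1}f(k)-G_{m_0,F}(n)\Big).$$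 *)

(* Defs.v *)
From mathcomp Require Import all_boot all_order all_algebra.
From mathcomp Require Import all_classical all_reals all_analysis.
Import Order.TTheory GRing.Theory Num.Theory.
Import numFieldNormedType.Exports.

Set Implicit Arguments.
Unset Strict Implicit.
Unset Printing Implicit Defensive.

Local Open Scope classical_set_scope.
Local Open Scope ring_scope.

Definition abs_continuous_on (R : realType) (a b : R) (h : R -> R) : Prop :=
  forall e : R, 0 < e -> exists2 d : R, 0 < d &
    forall (n : nat) (u v : 'I_n -> R),
      (forall i, a <= u i /\ u i <= v i /\ v i <= b) ->
      trivIset [set: 'I_n] (fun i => `]u i, v i[%classic) ->
      \sum_(i < n) (v i - u i) < d ->
      \sum_(i < n) `|h (v i) - h (u i)| < e.

(* On the whole line, absolute continuity means absolute continuity on every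
   bounded interval. *)
Definition abs_continuous (R : realType) (h : R -> R) : Prop :=
  forall a b : R, a <= b -> abs_continuous_on a b h.

(* [g] is a density, with respect to Lebesgue measure, of the signed measure
   with [mu ]a, b] = h b - h a].  It is determined only almost everywhere, so
   the top-order "derivative" of a function of class [Cminus] is passed around
   as a separate function satisfying this predicate. *)
Definition is_RN_derivative (R : realType) (h g : R -> R) : Prop :=
  forall a b : R, a <= b ->
    (@lebesgue_measure R).-integrable `[a, b] (EFin \o g) /\
    \int[@lebesgue_measure R]_(x in `[a, b]) g x = h b - h a.

(* The class C^{alpha-}, meaningful for [0 < alpha]. As [derive1n] is total,
   differentiability has to be required explicitly. *)
Definition Cminus (R : realType) (alpha : nat) (f : R -> R) : Prop :=
  [/\ forall i, (i.+1 < alpha)%N -> forall x : R, derivable (derive1n i f) x 1,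
      forall i, (i < alpha)%N -> continuous (derive1n i f)
    & abs_continuous (derive1n alpha.-1 f)].

Definition gamma_coef (R : realType) (m j : nat) : R :=
  (-1) ^+ j.-1 * (2 / j%:R) * ('C(2 * m, m + j)%:R / 'C(2 * m, m)%:R).

Definition G_sum (R : realType) (m : nat) (F : R -> R) (n : nat) : R :=
  \sum_(1 <= j < m.+1) gamma_coef R m j *
    \sum_(0 <= i < j) F (n%:R - 1 + j%:R / 2 - i%:R).

(* The remainder R_{m,f}(oo), with [g] in the role of f^(2m). *)
Definition R_infty (R : realType) (m : nat) (g : R -> R) : R :=
  (((2 * m).-1)`!%:R * 2 ^+ (2 * m).+1)^-1 *
  \int[@lebesgue_measure R]_(s in `[0, 1]) ((1 - s) ^+ (2 * m).-1 *
    \int[@lebesgue_measure R]_(v in `[-1, 1]) (v ^+ (2 * m) *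
      \sum_(1 <= j < m.+1) gamma_coef R m j * j%:R ^+ (2 * m).+1 *
        limn (series (fun k : nat => g (k%:R + j%:R * s * v / 2))))).

Definition alt_seq (R : realType) (m0 : nat) (f F : R -> R) (n : nat) : R :=
  \sum_(0 <= k < n) f k%:R - G_sum m0 F n.

Definition alt_sum (R : realType) (m0 : nat) (f F : R -> R) : R :=
  limn (alt_seq m0 f F).

(* Main.v *)
Require Import Defs.
From mathcomp Require Import all_boot all_order all_algebra.
From mathcomp Require Import all_classical all_reals all_analysis.
From mathcomp Require Import measurable_realfun ring lra zify.
Import Order.TTheory GRing.Theory Num.Theory.
Import numFieldNormedType.Exports.

(* Write G = G_(m,F), N = 2m.  The sum over i in G telescopes, so that
   G (k + 1) - G k = sum_j gamma_j (F (k + j/2) - F (k - j/2)).  Expanding F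
   about k leaves the odd derivatives weighted by sum_j gamma_j j^a, which is
   [a = 1] for odd a < 2m because it is a finite difference of order 2m of a
   polynomial of lower degree.  Hence G (k + 1) - G k = f k + R_k, where R_k is
   the Taylor remainder: the double integral of R_(m,f)(oo) with the series
   replaced by its k-th term.  Summing over k and using uniform convergence,
   the partial sums of f minus G_(m,F) converge to the right-hand side.
   Finally G_(m,F) - G_(m0,F) tends to 0: its Taylor expansion about n - 1/2
   has only moments killed by the same identities, and a remainder governed by
   f^(2 m0 - 1).

   Since f^(2m) is only locally integrable, the Taylor formula rests on a
   Leibniz rule for an absolutely continuous times a C^1 function, and the
   double integral is handled by Fubini's theorem: the inner integral over v may
   be unbounded near s = 0, but the factor v^(2m) makes the integrand summable
   on the rectangle. *)

Set Implicit Arguments.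
Unset Strict Implicit.
Unset Printing Implicit Defensive.

Local Open Scope classical_set_scope.
Local Open Scope ring_scope.

Local Notation mu := lebesgue_measure.

(** * Moments of the coefficients *)

(** An [N]-th finite difference kills polynomials of degree below [N]. Pascal's rule splits the sum
    into values at [x] and [x + 1]; in their difference the power [b] cancels, and the induction
    hypothesis kills the lower powers. *)
Lemma alternating_binomial_sum (R : comNzRingType) (N b : nat) (x : R) :
  (b < N)%N ->
  \sum_(i < N.+1) (-1) ^+ i * 'C(N, i)%:R * (x + i%:R) ^+ b = 0.
Proof.
elim: N b x => // N IH b x bN.
pose T i : R := (-1) ^+ i * 'C(N, i)%:R.
have -> : \sum_(i < N.+2) (-1) ^+ i * 'C(N.+1, i)%:R * (x + i%:R) ^+ b =
    \sum_(i < N.+1) T i * (x + i%:R) ^+ b -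
    \sum_(i < N.+1) T i * (x + i%:R + 1) ^+ b.
  rewrite big_ord_recl bin0 expr0.
  rewrite (eq_bigr (fun i : 'I_N.+1 => T i.+1 * (x + i.+1%:R) ^+ b -
    T i * (x + i%:R + 1) ^+ b)); last first.
    move=> i _; rewrite lift0 binS natrD /T -[in LHS]natr1 -[in RHS]natr1.
    by rewrite exprS addrA; ring.
  rewrite sumrB addrA; congr (_ - _).
  rewrite big_ord_recr /= [T N.+1]/T bin_small // mulr0 mul0r addr0.
  by rewrite [in RHS]big_ord_recl /= /T bin0 expr0 ?addr0.
rewrite -sumrB.
rewrite (eq_bigr (fun i : 'I_N.+1 => - \sum_(k < b)
    (T i * (x + i%:R) ^+ k) *+ 'C(b, k))); last first.
  move=> i _; rewrite -mulrBr [x + i%:R + 1]addrC (exprDn 1) big_ord_recr /=.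
  rewrite subnn binn mulr1n expr0 mul1r opprD addrCA subrr addr0 mulrN mulr_sumr.
  by congr (- _); apply: eq_bigr => k _; rewrite expr1n mul1r mulrnAr.
rewrite sumrN exchange_big /= big1 ?oppr0 // => k _.
by rewrite sumrMnl IH ?mul0rn // (leq_trans (ltn_ord k)).
Qed.

(** The previous identity at [x = - m] with [N = 2 * m] is symmetric about the central index [m]:
    since [b] is even, the terms at [m - j] and [m + j] agree, so the sum folds in two. *)
Lemma alternating_binomial_halfsum (R : comNzRingType) (m b : nat) :
  ~~ odd b -> (b < 2 * m)%N ->
  (b == 0%N)%:R * 'C(2 * m, m)%:R +
  2 * \sum_(1 <= j < m.+1) (-1) ^+ j * 'C(2 * m, m + j)%:R * j%:R ^+ b
  = 0 :> R.
Proof.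
move=> eb bm; have := alternating_binomial_sum (- m%:R : R) bm.
pose u (i : nat) : R := (-1) ^+ i * 'C(2 * m, i)%:R * (- m%:R + i%:R) ^+ b.
rewrite -(big_mkord xpredT u) (@big_cat_nat _ _ _ m) //=; last lia.
rewrite [X in _ + X]big_ltn; last lia.
pose t (j : nat) : R := (-1) ^+ j * 'C(2 * m, m + j)%:R * j%:R ^+ b.
have -> : \sum_(0 <= i < m) u i = (-1) ^+ m * \sum_(1 <= j < m.+1) t j.
  rewrite big_nat_rev /= add0n big_add1 /= mulr_sumr.
  rewrite !big_nat; apply: eq_bigr => i im; rewrite /u /t.
  have -> : 'C(2 * m, m - i.+1) = 'C(2 * m, m + i.+1).
    by rewrite -bin_sub; [congr 'C(_, _)|]; lia.
  rewrite natrB // addKr (exprNn i.+1%:R) -[(-1) ^+ b]signr_odd (negbTE eb) mul1r.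
  (* The exponents [m - i.+1] and [m + i.+1] differ but have the same parity. *)
  by rewrite !mulrA -exprD -[in LHS]signr_odd -[in RHS]signr_odd;
    congr ((-1) ^+ (nat_of_bool _) * _ * _); lia.
have -> : \sum_(m.+1 <= i < (2 * m).+1) u i =
    (-1) ^+ m * \sum_(1 <= j < m.+1) t j.
  rewrite -[m.+1 in LHS]add1n big_addn (_ : (2 * m).+1 - m = m.+1)%N; last lia.
  rewrite mulr_sumr; apply: eq_bigr => i _; rewrite /u /t.
  by rewrite natrD addrC addrK exprD [(i + m)%N]addnC; ring.
(* The central term has base [- m + m = 0], so it survives only for [b = 0], where [0 ^+ 0 = 1]. *)
rewrite {1}/u addNr expr0n => h.
apply: (can_inj (signrMK m)); rewrite mulr0 -[RHS]h; ring.
Qed.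

(** Allows sums of different orders to be written over one common range of [j]. *)
Lemma gamma_coef_eq0 (R : realType) (m j : nat) :
  (m < j)%N -> gamma_coef R m j = 0.
Proof. by move=> mj; rewrite /gamma_coef bin_small ?mul0r ?mulr0 //; lia. Qed.

(** The factor [2 / j] in [gamma_coef] lowers [j ^+ b.+1] to [j ^+ b], which leaves the folded
    binomial sum divided by the central binomial coefficient. *)
Lemma gamma_coef_moment (R : realType) (m b : nat) :
  ~~ odd b -> (b < 2 * m)%N ->
  \sum_(1 <= j < m.+1) gamma_coef R m j * j%:R ^+ b.+1 = (b == 0%N)%:R.
Proof.
move=> eb bm; have := alternating_binomial_halfsum R eb bm.
have C0 : 'C(2 * m, m)%:R != 0 :> R by rewrite pnatr_eq0 -lt0n bin_gt0; lia.
rewrite (_ : \sum_(1 <= j < m.+1) gamma_coef R m j * j%:R ^+ b.+1 =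
  - 2 * (\sum_(1 <= j < m.+1) (-1) ^+ j * 'C(2 * m, m + j)%:R * j%:R ^+ b) /
    'C(2 * m, m)%:R); last first.
  rewrite mulr_sumr mulr_suml.
  rewrite !big_nat; apply: eq_bigr => -[//|j] _; rewrite /gamma_coef exprS /=.
  rewrite [in RHS]exprS.
  have j0 : j.+1%:R != 0 :> R by rewrite pnatr_eq0.
  move: C0 j0; move: 'C(2 * m, m)%:R j.+1%:R => c x c0 x0.
  by field; rewrite x0 c0.
move=> h; apply: (mulIf C0); rewrite mulfVK //.
by move/eqP: h; rewrite addr_eq0 => /eqP ->; rewrite mulNr.
Qed.

Lemma G_sumS (R : realType) (m : nat) (F : R -> R) (n : nat) :
  G_sum m F n.+1 - G_sum m F n =
  \sum_(1 <= j < m.+1)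
    gamma_coef R m j * (F (n%:R + j%:R / 2) - F (n%:R - j%:R / 2)).
Proof.
rewrite /G_sum -sumrB; apply: eq_bigr => j _; rewrite -mulrBr; congr (_ * _).
(* The inner summands of [G_sum] at [n.+1] and at [n] are [a i] and [a i.+1]. *)
pose a i := F (n%:R + j%:R / 2 - i%:R).
rewrite -sumrB -[RHS]opprB.
have -> : F (n%:R + j%:R / 2) = a 0%N by rewrite /a subr0.
have -> : F (n%:R - j%:R / 2) = a j by rewrite /a; congr F; lra.
rewrite -(telescope_sumr a) // -sumrN; apply: eq_bigr => i _.
by rewrite opprB /a -!natr1; congr (F _ - F _); ring.
Qed.

(** A recurrence in the exponent for power sums over [j] unit-spaced points centred at 0. It comes
    from telescoping [(y + 1/2) ^+ n.+1 - (y - 1/2) ^+ n.+1] over these points and solving for the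
    coefficient of [y ^+ n]. *)
Lemma centred_power_sum (R : realType) (n j : nat) :
  n.+1%:R * \sum_(0 <= i < j) (((j%:R - 1) / 2 - i%:R) ^+ n : R) =
  (1 - (-1) ^+ n.+1) * (j%:R / 2) ^+ n.+1 -
  \sum_(0 <= k < n) ((1 - (-1) ^+ (n.+1 - k)) * (1 / 2) ^+ (n.+1 - k) *+ 'C(n.+1, k)) *
    \sum_(0 <= i < j) ((j%:R - 1) / 2 - i%:R) ^+ k.
Proof.
pose a i := (j%:R / 2 - i%:R : R) ^+ n.+1.
have tel : (1 - (-1) ^+ n.+1) * (j%:R / 2) ^+ n.+1 =
    \sum_(0 <= i < j) (a i - a i.+1).
  under eq_bigr do rewrite -opprB.
  rewrite sumrN telescope_sumr // opprB /a subr0.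
  rewrite (_ : j%:R / 2 - j%:R = - (j%:R / 2)); last by field.
  by rewrite (exprNn (j%:R / 2)); ring.
rewrite tel; under [X in _ = _ - X]eq_bigr do rewrite mulr_sumr.
rewrite exchange_big /= mulr_sumr -sumrB; apply: eq_bigr => i _.
set y : R := _ / 2 - _.
have -> : a i = (1 / 2 + y) ^+ n.+1 by rewrite /a /y; congr (_ ^+ _); field.
have -> : a i.+1 = (- (1 / 2) + y) ^+ n.+1.
  by rewrite /a /y -natr1; congr (_ ^+ _); field.
clear tel; move: y => y.
(* Of the two expansions, the powers [y ^+ n.+1] cancel, the terms in [y ^+ n] combine to the
   coefficient [n.+1], and the lower ones match the subtracted sum. *)
rewrite !exprDn -sumrB big_ord_recr big_ord_recr /=.
rewrite !subnn !expr0 subrr addr0 subSnn !expr1 binSn -(big_mkord xpredT (fun k : nat =>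
  (1 / 2) ^+ (n.+1 - k) * y ^+ k *+ 'C(n.+1, k) -
  (- (1 / 2)) ^+ (n.+1 - k) * y ^+ k *+ 'C(n.+1, k))) /=.
rewrite addrAC -sumrB big1 ?add0r => [|k _].
  by rewrite mulNr mulNrn opprK -mulrnDl -mulrDl -[RHS]mulr_natl; congr (_ * _); field.
rewrite (exprNn (1 / 2)) mulrnAl -!mulrnBl -[RHS](mul0rn _ 'C(n.+1, k)).
by congr (_ *+ _); ring.
Qed.

(** Strong induction through the recurrence: lower exponents vanish by induction, and the remaining
    term vanishes by its sign factor when [n] is odd and by the moment hypothesis when [n] is
    even. *)
Lemma weighted_centred_power_sum (R : realType) (D : nat -> R) (m r n : nat) :
  (forall b, ~~ odd b -> (b < 2 * r)%N ->
    \sum_(1 <= j < m) D j * j%:R ^+ b.+1 = 0) ->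
  (n < 2 * r)%N ->
  \sum_(1 <= j < m) D j * \sum_(0 <= i < j) ((j%:R - 1) / 2 - i%:R) ^+ n = 0.
Proof.
move=> hD; elim/ltn_ind: n => n IH nr.
apply: (mulfI (_ : n.+1%:R != 0)); first by rewrite pnatr_eq0.
rewrite mulr0 mulr_sumr.
under eq_bigr do rewrite mulrCA centred_power_sum mulrBr mulr_sumr.
rewrite sumrB exchange_big /=.
rewrite [X in _ - X]big1_seq ?subr0 => [|k]; last first.
  rewrite mem_index_iota => /andP[_ kn].
  by under eq_bigr do rewrite mulrCA; rewrite -mulr_sumr IH ?mulr0 //; lia.
have [on|en] := boolP (odd n).
  by rewrite big1 // => j _; rewrite -signr_odd /= on subrr mul0r mulr0.
under eq_bigr do rewrite exprMn mulrCA [D _ * _]mulrA mulrA.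
by rewrite -mulr_suml -mulr_sumr hD // mulr0 mul0r.
Qed.

(** * Affine changes of variable *)

Lemma measurable_affine (R : realType) (k y : R) :
  measurable_fun [set: R] (fun x : R => k + y * x).
Proof.
by apply: measurable_funD => //; apply: measurable_funM.
Qed.

(* The pushforward is a measure only through the explicitly named instance: its
   measurability argument cannot be inferred. *)
Lemma lebesgue_measure_affine (R : realType) (k y : R) (A : set R) :
  y != 0 -> measurable A ->
  (`|y|%:E * @lebesgue_measure R ((fun x : R => k + y * x)%R @^-1` A))%E =
  lebesgue_measure A.
Proof.
move=> y0 mA; apply/esym.
have mphi : @measurable_fun _ _ (measurableTypeR R) (measurableTypeR R) setT
    (fun x => k + y * x) by exact: measurable_affine.
pose nu := mscale (NngNum (normr_ge0 y))
  (measure_function_pushforward__canonical__measure_function_Measure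
     (@lebesgue_measure R) mphi).
(* By uniqueness it is enough that the rescaled pushforward [nu] gives half-open intervals their
   length; a negative [y] only moves the open end to the other side. *)
apply: (@lebesgue_measure_unique R nu _ A mA).
move=> _ [[a b]] _ <- /=.
rewrite [RHS](_ : _ = `|y|%:E * lebesgue_measure
  ((fun x : R => k + y * x)%R @^-1` `]a, b]))%E //.
have [yp|yn|y0'] := ltrgtP y 0; last by rewrite y0' eqxx in y0.
- rewrite [X in (_ * lebesgue_measure X)%E]
    (_ : _ = `[(b - k) / y, (a - k) / y[%classic); last first.
    apply/seteqP; split => x /=; rewrite !in_itv /= ler_ndivrMr // ltr_ndivlMr // => h; lra.
  rewrite !lebesgue_measure_itv /= !lte_fin ltr_nM2r ?invr_lt0 // ltrD2r.
  case: ifPn => _; rewrite ?mule0 // -EFinB -EFinB -EFinM.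
  by congr (_%:E); rewrite ltr0_norm //; field.
- rewrite [X in (_ * lebesgue_measure X)%E]
    (_ : _ = `](a - k) / y, (b - k) / y]%classic); last first.
    apply/seteqP; split => x /=; rewrite !in_itv /= ltr_pdivrMr // ler_pdivlMr // => h; lra.
  rewrite !lebesgue_measure_itv /= !lte_fin ltr_pM2r ?invr_gt0 // ltrD2r.
  case: ifPn => _; rewrite ?mule0 // -EFinB -EFinB -EFinM.
  by congr (_%:E); rewrite gtr0_norm //; field.
Qed.

Lemma ge0_integral_affine (R : realType) (k y : R) (D : set R) (f : R -> \bar R) :
  y != 0 -> measurable D -> measurable_fun D f ->
  (forall x, D x -> 0 <= f x)%E ->
  (`|y|%:E * \int[@lebesgue_measure R]_(x in (fun x : R => k + y * x)%R @^-1` D)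
     f (k + y * x)%R)%E = (\int[@lebesgue_measure R]_(x in D) f x)%E.
Proof.
move=> y0 mD mf f0.
have mphi : @measurable_fun _ _ (measurableTypeR R) (measurableTypeR R) setT
    (fun x => k + y * x) by exact: measurable_affine.
pose nu := mscale (NngNum (normr_ge0 y))
  (measure_function_pushforward__canonical__measure_function_Measure
     (@lebesgue_measure R) mphi).
rewrite [RHS](eq_measure_integral nu); last first.
  by move=> A mA _; exact/esym/lebesgue_measure_affine.
by rewrite ge0_integral_mscale // ge0_integral_pushforward // => x /[!inE] /f0.
Qed.

Lemma integrable_affine (R : realType) (k y : R) (D : set R) (f : R -> R) :
  y != 0 -> measurable D ->
  (@lebesgue_measure R).-integrable D (EFin \o f) ->
  (@lebesgue_measure R).-integrable ((fun x : R => k + y * x) @^-1` D)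
    (EFin \o (fun x => f (k + y * x))).
Proof.
move=> y0 mD /integrableP[mf foo]; apply/integrableP; split.
  apply: (@measurable_comp _ _ _ _ _ _ D (EFin \o f) _
    (fun x : R => k + y * x)) => //; first by move=> _ [x Dx <-].
  exact: measurable_funTS (measurable_affine k y).
rewrite -(@lte_pmul2l _ `|y|%:E) //; last by rewrite lte_fin normr_gt0.
rewrite (@ge0_integral_affine R k y D (fun x => `|(f x)%:E|)%E) //;
  last exact: measurableT_comp.
by rewrite mulry gtr0_sg ?normr_gt0 // mul1e.
Qed.

(** The nonnegative formula is applied to the positive and negative parts; integrability keeps their
    difference meaningful. *)
Lemma Rintegral_affine (R : realType) (k y : R) (D : set R) (f : R -> R) :
  y != 0 -> measurable D ->
  (@lebesgue_measure R).-integrable D (EFin \o f) ->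
  `|y| * \int[@lebesgue_measure R]_(x in (fun x : R => k + y * x)%R @^-1` D)
     f (k + y * x) = \int[@lebesgue_measure R]_(x in D) f x.
Proof.
move=> y0 mD fi; have mf := measurable_int _ fi.
have fyi := integrable_affine k y0 mD fi.
have mD' : measurable ((fun x : R => k + y * x)%R @^-1` D).
  by rewrite -[X in measurable X]setTI; exact: measurable_affine.
rewrite -[`|y|]/(fine `|y|%:E) /Rintegral -fineM //; last first.
  exact: integrable_fin_num fyi.
congr fine; rewrite integralE [RHS]integralE muleBr //; last first.
  by rewrite fin_num_adde_defl // fin_numN; exact: integrable_neg_fin_num fyi.
congr (_ - _)%E; rewrite -[RHS](ge0_integral_affine k y0) //.
- congr (_ * _)%E; apply: eq_integral => x _.
  by rewrite !funeposE.
- exact: measurable_funepos.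
- congr (_ * _)%E; apply: eq_integral => x _.
  by rewrite !funenegE.
- exact: measurable_funeneg.
Qed.

Lemma preimage_affine_itv (R : realType) (k y a b : R) : 0 < y ->
  (fun x : R => k + y * x) @^-1` `[k + y * a, k + y * b] = `[a, b]%classic.
Proof.
by move=> y0; apply/seteqP; split => x /=; rewrite !in_itv /= !lerD2l !ler_pM2l.
Qed.

Lemma preimage_affine_itvN (R : realType) (k y a b : R) : y < 0 ->
  (fun x : R => k + y * x) @^-1` `[k + y * b, k + y * a] = `[a, b]%classic.
Proof.
by move=> y0; apply/seteqP; split => x /=; rewrite !in_itv /= !lerD2l !ler_nM2l // andbC.
Qed.

(** For [y < 0] the endpoints are exchanged and [|y| = - y]; the two signs cancel. For [y = 0] both
    sides are zero. *)
Lemma is_RN_derivative_affine (R : realType) (k y : R) (h g : R -> R) :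
  is_RN_derivative h g ->
  is_RN_derivative (fun x => h (k + y * x)) (fun x => y * g (k + y * x)).
Proof.
move=> hg a b ab; have [yn|yp|->] := ltrgtP y 0.
- have kab : k + y * b <= k + y * a by rewrite lerD2l ler_nM2l.
  have [gi gE] := hg _ _ kab.
  have := integrable_affine k (ltr0_neq0 yn) (measurable_itv _) gi.
  have := Rintegral_affine k (ltr0_neq0 yn) (measurable_itv _) gi.
  rewrite preimage_affine_itvN // gE => E i; split.
    exact: integrableZl i.
  by move: E; rewrite RintegralZl // ltr0_norm // mulNr => /(congr1 -%R); rewrite opprK opprB.
- have kab : k + y * a <= k + y * b by rewrite lerD2l ler_pM2l.
  have [gi gE] := hg _ _ kab.
  have := integrable_affine k (lt0r_neq0 yp) (measurable_itv _) gi.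
  have := Rintegral_affine k (lt0r_neq0 yp) (measurable_itv _) gi.
  rewrite preimage_affine_itv // gE => E i; split.
    exact: integrableZl i.
  by move: E; rewrite RintegralZl // gtr0_norm.
- rewrite !mul0r subrr; split.
    by apply: eq_integrable (integrable0 _ _) => // x _ /=; rewrite mul0r.
  by under eq_Rintegral do rewrite mul0r; rewrite Rintegral_cst // mul0r.
Qed.

(** * Taylor's formula with an integrable top derivative *)

Lemma continuous_itv_bounded (R : realType) (f : R -> R) (a b : R) :
  continuous f -> exists2 M : R, 0 <= M &
    forall x, a <= x <= b -> `|f x| <= M.
Proof.
move=> cf.
have /compact_bounded[M [_ hM]] : compact (f @` `[a, b]%classic).
  by apply: continuous_compact; [exact: continuous_subspaceT|exact: segment_compact].
(* [compact_bounded] gives the bound for every number strictly above [M], and a nonnegative one is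
   wanted. *)
exists (`|M| + 1) => [|x xab]; first by rewrite addr_ge0.
have MM : M < `|M| + 1 by rewrite (le_lt_trans (ler_norm M)) // ltrDl.
by apply: (hM _ MM); exists x => //=; rewrite in_itv.
Qed.

Lemma continuous_itv_integrable (R : realType) (f : R -> R) (a b : R) :
  continuous f -> (@lebesgue_measure R).-integrable `[a, b] (EFin \o f).
Proof.
move=> cf; apply: continuous_compact_integrable; first exact: segment_compact.
exact: continuous_subspaceT.
Qed.

Lemma continuous_mul_integrable (R : realType) (f g : R -> R) (a b : R) :
  continuous f -> (@lebesgue_measure R).-integrable `[a, b] (EFin \o g) ->
  (@lebesgue_measure R).-integrable `[a, b] (EFin \o (fun x => f x * g x)).
Proof.
move=> cf gi.
have [M M0 hM] := continuous_itv_bounded a b cf.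
apply: (integrableMr _ _ _ gi) => //.
  by apply: measurable_funTS; exact: continuous_measurable_fun.
exists M; split; first exact: num_real.
move=> N MN x /=; rewrite in_itv /= => /hM h; exact: le_trans h (ltW MN).
Qed.

Lemma is_derive1_continuous (R : realType) (f df : R -> R) :
  (forall x : R, is_derive x (1 : R) f (df x)) -> continuous f.
Proof.
move=> dF x; apply/differentiable_continuous/derivable1_diffP.
exact: (@ex_derive _ _ _ _ _ _ _ (dF x)).
Qed.

Lemma Rintegral_derive (R : realType) (f F : R -> R) (a b : R) :
  a <= b -> (forall x : R, is_derive x (1 : R) F (f x)) -> continuous f ->
  \int[@lebesgue_measure R]_(x in `[a, b]) f x = F b - F a.
Proof.
move=> ab dF cf; move: ab; rewrite le_eqVlt => /predU1P[->|ab].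
  by rewrite set_itv1 Rintegral_set1 subrr.
rewrite /Rintegral (@continuous_FTC2 _ f F) //.
- exact: continuous_subspaceT.
- have cF := is_derive1_continuous dF.
  split.
  + by move=> x _; exact: (@ex_derive _ _ _ _ _ _ _ (dF x)).
  + by apply: cvg_at_right_filter; exact: cF.
  + by apply: cvg_at_left_filter; exact: cF.
- by move=> x _; rewrite derive1E (@derive_val _ _ _ _ _ _ _ (dF x)).
Qed.

Lemma normr_Rintegral_le d (T : measurableType d) (R : realType)
    (mu : {measure set T -> \bar R}) (D : set T) (f g : T -> R) :
  measurable D -> mu.-integrable D (EFin \o f) ->
  mu.-integrable D (EFin \o g) -> (forall x, D x -> `|f x| <= g x) ->
  `|\int[mu]_(x in D) f x| <= \int[mu]_(x in D) g x.
Proof.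
move=> mD fi gi fg; apply: le_trans (le_normr_Rintegral mD fi) _.
by apply: le_Rintegral => //; exact: integrable_norm.
Qed.

(* The increments of [E] are of second order in the mesh, so they sum to
   zero along finer and finer uniform partitions. *)
Lemma quadratic_increments_eq (R : realType) (E V : R -> R) (C a b : R) :
  0 <= C -> a <= b ->
  (forall u v, a <= u -> u <= v -> v <= b ->
    `|E v - E u| <= C * (v - u) * (V v - V u)) ->
  E b = E a.
Proof.
move=> C0 ab hE; apply/eqP; rewrite -subr_eq0 -normr_le0 leNgt; apply/negP => e0.
set e := `|E b - E a| in e0.
pose K := C * (b - a) * (V b - V a).
(* With [n] equal parts the total increment is at most [K / n]; this [n] pushes it below [e], a
   contradiction. *)
pose n := (Num.truncn (K / e)).+1.
have n0 : 0 < n%:R :> R by rewrite ltr0n.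
pose t (i : nat) : R := a + i%:R * ((b - a) / n%:R).
have d0 : 0 <= (b - a) / n%:R by rewrite divr_ge0 ?subr_ge0 // ltW.
have tn : t n = b by rewrite /t; field; rewrite gt_eqF.
have t0 : t 0%N = a by rewrite /t mul0r addr0.
(* The mesh factors out of each bound and the increments of [V] telescope. *)
have h i : (i <= n)%N ->
    `|E (t i) - E a| <= C * ((b - a) / n%:R) * (V (t i) - V a).
  elim: i => [|i IH] iln; first by rewrite t0 !subrr normr0 mulr0.
  have tS : t i.+1 - t i = (b - a) / n%:R by rewrite /t -natr1; ring.
  have -> : E (t i.+1) - E a = (E (t i.+1) - E (t i)) + (E (t i) - E a) by ring.
  apply: le_trans (ler_normD _ _) _.
  rewrite (_ : V (t i.+1) - V a = (V (t i.+1) - V (t i)) + (V (t i) - V a)); last by ring.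
  rewrite mulrDr lerD ?IH 1?ltnW //.
  rewrite -{1}tS; apply: hE.
  - by rewrite /t lerDl mulr_ge0.
  - by rewrite -subr_ge0 tS.
  - by rewrite -tn /t lerD2l ler_wpM2r // ler_nat.
have := h n (leqnn n); rewrite tn -/e => he.
have Kn : e * n%:R <= K.
  apply: le_trans (ler_wpM2r (ltW n0) he) _; rewrite le_eqVlt; apply/orP; left.
  by apply/eqP; rewrite /K; field; rewrite gt_eqF.
have : K / e < n%:R by rewrite /n truncnS_gt.
by rewrite ltr_pdivrMr // mulrC ltNge Kn.
Qed.

Lemma RintegrableD d (T : measurableType d) (R : realType)
    (nu : {measure set T -> \bar R}) (D : set T) (f g : T -> R) :
  measurable D -> nu.-integrable D (EFin \o f) ->
  nu.-integrable D (EFin \o g) ->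
  nu.-integrable D (EFin \o (fun x => f x + g x)).
Proof. by move=> mD fi gi; exact: (integrableD mD fi gi). Qed.

Lemma RintegrableB d (T : measurableType d) (R : realType)
    (nu : {measure set T -> \bar R}) (D : set T) (f g : T -> R) :
  measurable D -> nu.-integrable D (EFin \o f) ->
  nu.-integrable D (EFin \o g) ->
  nu.-integrable D (EFin \o (fun x => f x - g x)).
Proof. by move=> mD fi gi; exact: (integrableB mD fi gi). Qed.

Lemma RintegrableZl d (T : measurableType d) (R : realType)
    (nu : {measure set T -> \bar R}) (D : set T) (r : R) (f : T -> R) :
  measurable D -> nu.-integrable D (EFin \o f) ->
  nu.-integrable D (EFin \o (fun x => r * f x)).
Proof. by move=> mD fi; exact: (integrableZl mD r fi). Qed.

Lemma Rintegral_itvl_le (R : realType) (g : R -> R) (u x v : R) :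
  u <= x -> x <= v -> mu.-integrable `[u, v] (EFin \o g) ->
  (forall x, 0 <= g x) ->
  \int[mu]_(t in `[u, x]) g t <= \int[mu]_(t in `[u, v]) g t.
Proof.
move=> ux xv gi g0; rewrite -subr_ge0 Rintegral_itvB ?bnd_simp //.
exact: Rintegral_ge0.
Qed.

Lemma Rintegral_itv_diff (R : realType) (g : R -> R) (a u v : R) :
  a <= u -> u <= v -> mu.-integrable `[a, v] (EFin \o g) ->
  \int[mu]_(x in `[a, v]) g x - \int[mu]_(x in `[a, u]) g x =
  \int[mu]_(x in `[u, v]) g x.
Proof.
move=> au uv gi; rewrite Rintegral_itvB ?bnd_simp // Rintegral_itv_obnd_cbnd //.
by apply: integrableS gi => //; apply: subset_itv; rewrite bnd_simp.
Qed.

Lemma Rintegral_itv_cst (R : realType) (u v c : R) :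
  u <= v -> \int[mu]_(x in `[u, v]) c = c * (v - u).
Proof.
rewrite le_eqVlt => /predU1P[->|uv].
  by rewrite set_itv1 Rintegral_set1 subrr mulr0.
by rewrite Rintegral_cst //= lebesgue_measure_itv /= lte_fin uv.
Qed.

(** No pointwise derivative of [h] is available, so the defect [E] between the integral and the
    product is shown to be constant through its increments: on [[u, v]] they are at most the length
    times the integral of [|g|], up to a constant. *)
Lemma is_RN_derivative_mul (R : realType) (h g p dp : R -> R) :
  continuous h -> is_RN_derivative h g ->
  (forall x : R, is_derive x (1 : R) p (dp x)) -> continuous dp ->
  is_RN_derivative (fun x => p x * h x) (fun x => p x * g x + dp x * h x).
Proof.
move=> ch hg dP cdp a b ab.
have cp := is_derive1_continuous dP.
have gi u v : u <= v -> mu.-integrable `[u, v] (EFin \o g) by move=> /hg[].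
have gE u v : u <= v -> \int[mu]_(x in `[u, v]) g x = h v - h u by move=> /hg[].
have pgi u v : u <= v -> mu.-integrable `[u, v] (EFin \o (fun x => p x * g x)).
  by move=> uv; apply: continuous_mul_integrable => //; exact: gi.
have dphi u v : mu.-integrable `[u, v] (EFin \o (fun x => dp x * h x)).
  by apply: continuous_itv_integrable => x; apply: cvgM; [exact: cdp|exact: ch].
pose w x := p x * g x + dp x * h x.
have wi u v : u <= v -> mu.-integrable `[u, v] (EFin \o w).
  by move=> uv; apply: RintegrableD => //; exact: pgi.
split; first exact: wi.
have [M M0 hM] := continuous_itv_bounded a b cdp.
pose V t := \int[mu]_(x in `[a, t]) `|g x|.
pose E t := \int[mu]_(x in `[a, t]) w x - p t * h t.
suff : E b = E a.
  rewrite /E set_itv1 Rintegral_set1 add0r => /eqP; rewrite subr_eq => /eqP ->.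
  by rewrite addrC.
apply: (@quadratic_increments_eq _ E V (2 * M)) => //; first by rewrite mulr_ge0.
move=> u v au uv vb.
have av := le_trans au uv.
have nE : V v - V u = \int[mu]_(x in `[u, v]) `|g x|.
  by rewrite /V Rintegral_itv_diff //; exact/integrable_norm/gi.
have V0 : 0 <= V v - V u by rewrite nE; exact: Rintegral_ge0.
have c1 : continuous (fun x => p x - p v) by move=> x; apply: cvgB; [exact: cp|exact: cvg_cst].
have c2 : continuous (fun x => h x - h u) by move=> x; apply: cvgB; [exact: ch|exact: cvg_cst].
have i1 : mu.-integrable `[u, v] (EFin \o (fun x => (p x - p v) * g x)).
  by apply: continuous_mul_integrable => //; exact: gi.
have i2 : mu.-integrable `[u, v] (EFin \o (fun x => dp x * (h x - h u))).
  by apply: continuous_itv_integrable => x; apply: cvgM; [exact: cdp|exact: c2].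
have dpi s t : mu.-integrable `[s, t] (EFin \o dp) by exact: continuous_itv_integrable.
(* Freezing [p] at the right end and [h] at the left end makes the constant parts add up to exactly
   [p v * h v - p u * h u]. *)
have -> : E v - E u = \int[mu]_(x in `[u, v]) ((p x - p v) * g x) +
    \int[mu]_(x in `[u, v]) (dp x * (h x - h u)).
  have -> : E v - E u = \int[mu]_(x in `[u, v]) w x - (p v * h v - p u * h u).
    by rewrite /E -(Rintegral_itv_diff au uv (wi _ _ av)); ring.
  have -> : \int[mu]_(x in `[u, v]) ((p x - p v) * g x) =
      \int[mu]_(x in `[u, v]) (p x * g x) - p v * (h v - h u).
    rewrite -gE // -RintegralZl //; last exact: gi.
    rewrite -RintegralB //; [|exact: pgi|by apply: RintegrableZl => //; exact: gi].
    by apply: eq_Rintegral => x _; rewrite mulrBl.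
  have -> : \int[mu]_(x in `[u, v]) (dp x * (h x - h u)) =
      \int[mu]_(x in `[u, v]) (dp x * h x) - h u * (p v - p u).
    rewrite -(Rintegral_derive uv dP) // -RintegralZl //.
    rewrite -RintegralB //; last exact: RintegrableZl.
    by apply: eq_Rintegral => x _; rewrite mulrBr [h u * _]mulrC.
  by rewrite RintegralD //; [ring|exact: pgi].
have B1 : `|\int[mu]_(x in `[u, v]) ((p x - p v) * g x)| <= M * (v - u) * (V v - V u).
  rewrite nE -RintegralZl //; last exact/integrable_norm/gi.
  apply: normr_Rintegral_le => // [|x].
    by apply: RintegrableZl => //; exact/integrable_norm/gi.
  rewrite /= in_itv /= => /andP[ux xv]; rewrite normrM ler_wpM2r //.
  rewrite distrC -(Rintegral_derive xv dP) //.
  have xiv : \int[mu]_(x in `[x, v]) M = M * (v - x).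
    exact: Rintegral_itv_cst.
  apply: (@le_trans _ _ (M * (v - x))); last by rewrite ler_wpM2l // lerD2l lerN2.
  rewrite -xiv; apply: normr_Rintegral_le => //.
  - exact: continuous_itv_integrable (@cst_continuous _ _ M).
  - move=> y /=; rewrite in_itv /= => /andP[xy yv]; apply: hM; lra.
(* Here the increment of [h] is bounded by the integral of [|g|], whereas in [B1] that of [p] is
   bounded by [M] times the length. *)
have B2 : `|\int[mu]_(x in `[u, v]) (dp x * (h x - h u))| <= M * (v - u) * (V v - V u).
  have -> : M * (v - u) * (V v - V u) = \int[mu]_(x in `[u, v]) (M * (V v - V u)).
    by rewrite Rintegral_itv_cst //; ring.
  apply: normr_Rintegral_le => // [|x].
    exact: continuous_itv_integrable (@cst_continuous _ _ _).
  rewrite /= in_itv /= => /andP[ux xv]; rewrite normrM ler_pM //; first by apply: hM; lra.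
  rewrite -gE // nE.
  apply: le_trans (le_normr_Rintegral _ (gi _ _ ux)) _ => //.
  by apply: Rintegral_itvl_le => //; exact/integrable_norm/gi.
apply: le_trans (ler_normD _ _) _.
rewrite (_ : 2 * M * (v - u) * (V v - V u) =
  M * (v - u) * (V v - V u) + M * (v - u) * (V v - V u)); last by ring.
exact: lerD.
Qed.

(** The slope [y = 0] has to be covered, since [k + h * s * v] degenerates at [s = 0]; elsewhere the
    density [y * g (k + y * s)] is divided by [y]. *)
Lemma is_RN_derivative_integrable_affine (R : realType) (h g : R -> R) (k y a b : R) :
  is_RN_derivative h g ->
  mu.-integrable `[a, b] (EFin \o (fun s => g (k + y * s))).
Proof.
move=> hg; have [ab|ba] := leP a b; last first.
  by rewrite set_itv_ge ?bnd_simp -?ltNge //; exact: integrable_set0.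
have [->|y0] := eqVneq y 0.
  have c : continuous (fun _ : R => g k) by move=> x; exact: cvg_cst.
  apply: eq_integrable (continuous_itv_integrable a b c) => // x _.
  by rewrite /= mul0r addr0.
have [gi _] := is_RN_derivative_affine k y hg ab.
have : mu.-integrable `[a, b] (EFin \o (fun s => y^-1 * (y * g (k + y * s)))).
  exact: RintegrableZl.
by apply: eq_integrable => // x _ /=; rewrite mulKf.
Qed.

Lemma is_RN_derivative_C1 (R : realType) (f df : R -> R) :
  (forall x : R, is_derive x (1 : R) f (df x)) -> continuous df ->
  is_RN_derivative f df.
Proof.
by move=> fd cdf a b ab; split;
  [exact: continuous_itv_integrable|exact: Rintegral_derive].
Qed.

Lemma is_derive_onem_exp (R : realType) (n : nat) (x : R) :
  is_derive x (1 : R) (fun s => (1 - s) ^+ n) (- (n%:R * (1 - x) ^+ n.-1)).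
Proof.
have -> : (fun s : R => (1 - s) ^+ n) = (fun s => 1 - s) ^+ n.
  by apply/funext => s; rewrite exprfctE.
have d : is_derive x (1 : R) (fun s : R => 1 - s) (0 - 1) by apply: is_deriveB.
apply: is_derive_eq (is_deriveX n d) _.
by rewrite -[_ *: _]/(_ * _) sub0r mulrN1.
Qed.

Lemma continuous_onem_exp (R : realType) (n : nat) :
  continuous (fun s : R => (1 - s) ^+ n).
Proof. exact: is_derive1_continuous (@is_derive_onem_exp R n). Qed.

(** Induction on the order. The formula one order lower has the continuous [d N.+1] as its density,
    and one integration by parts with the Leibniz rule brings in [g]. *)
Lemma is_RN_derivative_taylor (R : realType) (N : nat) (d : nat -> R -> R)
    (g : R -> R) (k y : R) :
  (forall i, (i < N)%N -> forall x : R, is_derive x (1 : R) (d i) (d i.+1 x)) ->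
  continuous (d N) -> is_RN_derivative (d N) g ->
  d 0%N (k + y) = \sum_(i < N.+1) d i k * y ^+ i / i`!%:R +
    y ^+ N.+1 / N`!%:R * \int[mu]_(s in `[0, 1]) ((1 - s) ^+ N * g (k + y * s)).
Proof.
elim: N g => [|N IH] g hd cd hg.
  have [_ E] := is_RN_derivative_affine k y hg (ler01 : 0 <= 1 :> R).
  move: E; rewrite RintegralZl //; last exact: (is_RN_derivative_integrable_affine k y 0 1 hg).
  rewrite mulr1 mulr0 addr0 => E.
  under eq_Rintegral do rewrite expr0 mul1r.
  by rewrite big_ord1 expr1 fact0 expr0 !divr1 mulr1 E; ring.
have gk := is_RN_derivative_integrable_affine k y 0 1 hg.
have hdN i : (i < N)%N -> forall x : R, is_derive x (1 : R) (d i) (d i.+1 x).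
  by move=> iN; apply: hd; exact: ltnW.
have dN := hd N (ltnSn N).
rewrite (IH _ hdN (is_derive1_continuous dN) (is_RN_derivative_C1 dN cd)).
rewrite [in RHS]big_ord_recr /= -addrA; congr (_ + _).
have ch : continuous (fun s => d N.+1 (k + y * s)).
  move=> x; apply: continuous_comp; last exact: cd.
  by apply: cvgD; [exact: cvg_cst|apply: cvgM; [exact: cvg_cst|exact: cvg_id]].
have cdp : continuous (fun s : R => - (N.+1%:R * (1 - s) ^+ N)).
  move=> x; apply: cvgN; apply: cvgM; first exact: cvg_cst.
  exact: continuous_onem_exp.
have [_] := is_RN_derivative_mul ch (is_RN_derivative_affine k y hg)
  (@is_derive_onem_exp R N.+1) cdp (ler01 : 0 <= 1 :> R).
(* The boundary term at [s = 1] vanishes because the exponent [N.+1] is positive. *)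
rewrite subrr expr0n mul0r subr0 expr1n mul1r mulr0 addr0 sub0r.
rewrite RintegralD //; last 2 first.
- apply: continuous_mul_integrable; first exact: continuous_onem_exp.
  exact: RintegrableZl.
- by apply: continuous_itv_integrable => x; apply: cvgM; [exact: cdp|exact: ch].
set I1 := \int[mu]_(s in `[0, 1]) ((1 - s) ^+ N * d N.+1 (k + y * s)).
set I2 := \int[mu]_(s in `[0, 1]) ((1 - s) ^+ N.+1 * g (k + y * s)).
have -> : \int[mu]_(x in `[0, 1]) ((1 - x) ^+ N.+1 * (y * g (k + y * x))) = y * I2.
  under eq_Rintegral do rewrite mulrCA.
  rewrite RintegralZl //; apply: continuous_mul_integrable => //.
  exact: continuous_onem_exp.
have -> : \int[mu]_(x in `[0, 1])
    (- (N.+1%:R * (1 - x) ^+ N) * d N.+1 (k + y * x)) = - N.+1%:R * I1.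
  under eq_Rintegral do rewrite -mulNr -mulrA.
  rewrite RintegralZl //.
  apply: continuous_itv_integrable => x.
  by apply: cvgM; [exact: continuous_onem_exp|exact: ch].
move=> E.
have N0 : N.+1%:R != 0 :> R by rewrite pnatr_eq0.
have F0 : N`!%:R != 0 :> R by rewrite pnatr_eq0 -lt0n fact_gt0.
have -> : I1 = (d N.+1 k + y * I2) / N.+1%:R.
  by apply: (mulIf N0); rewrite mulfVK //; lra.
rewrite factS natrM [y ^+ N.+2]exprS.
move: N0 F0; move: N.+1%:R N`!%:R => a b a0 b0.
by field; rewrite a0 b0.
Qed.

(** * The double integral of the remainder *)

Lemma ge0_integral_affineT (R : realType) (k y : R) (f : R -> \bar R) :
  y != 0 -> measurable_fun [set: R] f -> (forall x, 0 <= f x)%E ->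
  (`|y|%:E * \int[@lebesgue_measure R]_x f (k + y * x)%R)%E =
  (\int[@lebesgue_measure R]_x f x)%E.
Proof.
move=> y0 mf f0.
by rewrite -(@ge0_integral_affine R k y setT f) // preimage_setT.
Qed.

(** The indicators extend the integrand by zero from the rectangle to the plane, so that Fubini is
    used on the full product space. In the application [N] is [2 * m - 1] and [h] is [j / 2]. *)
Definition scaled_kernel (R : realType) (N : nat) (g : R -> R) (k h : R)
    (z : measurableTypeR R * measurableTypeR R) : R :=
  \1_`[0 : R, 1]%classic z.1 * (1 - z.1) ^+ N *
  (\1_`[-1 : R, 1]%classic z.2 * z.2 ^+ N.+1) * g (k + h * z.1 * z.2).

Lemma measurable_scaled_kernel (R : realType) (N : nat) (g : R -> R) (k h : R) :
  measurable_fun [set: R] g -> measurable_fun setT (scaled_kernel N g k h).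
Proof.
move=> mg; pose T := measurableTypeR R.
have m1 : measurable_fun [set: T * T] (fun z : T * T => z.1 : R) by exact: measurable_fst.
have m2 : measurable_fun [set: T * T] (fun z : T * T => z.2 : R) by exact: measurable_snd.
have mc (p : T * T -> R) (q : R -> R) : measurable_fun [set: T * T] p ->
    measurable_fun [set: R] q -> measurable_fun [set: T * T] (fun z => q (p z)).
  by move=> mp mq; exact: (measurableT_comp mq mp).
apply: measurable_funM; first (apply: measurable_funM; apply: measurable_funM).
- by apply: (mc _ _ m1); exact: measurable_indic.
- apply: (mc _ (fun x => (1 - x) ^+ N) m1).
  by apply: continuous_measurable_fun; exact: continuous_onem_exp.
- by apply: (mc _ _ m2); exact: measurable_indic.
- apply: (mc _ (fun x => x ^+ N.+1) m2).
  by apply: continuous_measurable_fun; exact: exprn_continuous.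
- apply: (mc (fun z => k + h * z.1 * z.2) g) => //.
  apply: measurable_funD => //.
  by apply: measurable_funM => //; apply: measurable_funM.
Qed.

(** Tonelli with [s] integrated first: for fixed [v != 0] the substitution [x = k + h * v * s] costs
    a factor [1 / (h * |v|)], which one of the factors of [v ^+ N.+1] absorbs. The bound [C] is thus
    uniform in [v]. *)
Lemma integrable_scaled_kernel (R : realType) (N : nat) (g : R -> R) (k h : R) :
  0 < h -> mu.-integrable [set: R] (EFin \o g) ->
  (@lebesgue_measure R \x @lebesgue_measure R)%E.-integrable setT
    (EFin \o scaled_kernel N g k h).
Proof.
move=> h0 gi.
have mg : measurable_fun [set: R] g.
  by apply/measurable_EFinP; exact: (measurable_int _ gi).
apply/integrable21ltyP.
  by apply/measurable_EFinP; exact: measurable_scaled_kernel.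
have mk := measurable_scaled_kernel N k h mg.
have [_ goo] := integrableP _ _ _ gi.
set G := (\int[_]_(x in _) _)%E in goo.
pose C : \bar R := (h^-1%:E * G)%E.
have C0 : (0 <= C)%E by rewrite mule_ge0 ?lee_fin ?invr_ge0 ?(ltW h0) //; exact: integral_ge0.
have Coo : (C < +oo)%E by rewrite lte_mul_pinfty ?lee_fin ?invr_ge0 ?(ltW h0).
apply: (@le_lt_trans _ _ (\int[@lebesgue_measure R]_(v in `[(-1)%R, 1%R]) C)%E); last first.
  rewrite integral_cst //= lebesgue_measure_itv /= lte_fin gtrN //.
  by rewrite lte_mul_pinfty // ?ge0_fin_numE // -EFinD ltry.
rewrite [leRHS]integral_mkcond; apply: ge0_le_integral => //.
- by move=> v _; exact: integral_ge0.
- apply: (measurable_fun_fubini_tonelli_G (fun z => `|(scaled_kernel N g k h z)%:E|)%E) => //.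
  by apply: measurableT_comp => //; exact/measurable_EFinP.
- by apply/(measurable_restrictT _ _).1 => //; exact: measurable_cst.
- move=> v _; rewrite /patch /scaled_kernel /=; case: ifPn => vB; last first.
    rewrite integral0_eq // => s _.
    have -> : \1_`[-1 : R, 1]%classic v = 0 :> R by rewrite indicE (negbTE vB).
    by rewrite mul0r mulr0 mul0r normr0.
  have [->|v0] := eqVneq v 0.
    by rewrite integral0_eq // => s _; rewrite expr0n /= mulr0 mulr0 mul0r normr0.
  have hv0 : h * v != 0 by rewrite mulf_neq0 // gt_eqF.
  have -> : C = (`|v|%:E * \int[@lebesgue_measure R]_s `|(g (k + h * v * s)%R)%:E|)%E.
    rewrite /C /G -(@ge0_integral_affineT R k (h * v) (fun x => `|(g x)%:E|)%E) //.
      rewrite muleA -EFinM normrM gtr0_norm // mulKf ?gt_eqF //.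
    by apply: measurableT_comp => //; exact/measurable_EFinP.
  have mgv : measurable_fun [set: R] (fun s : R => `|(g (k + h * v * s)%R)%:E|%E).
    apply: measurableT_comp => //; apply/measurable_EFinP.
    exact: (measurableT_comp mg (measurable_affine k (h * v))).
  have mkv : measurable_fun [set: R] (fun s : R => scaled_kernel N g k h (s, v)).
    exact: (measurableT_comp mk
      (@pair2_measurable _ _ (measurableTypeR R) (measurableTypeR R) v)).
  rewrite -ge0_integralZl //; apply: ge0_le_integral => //.
  + by apply/measurable_EFinP; exact: (measurableT_comp (@normr_measurable R setT) mkv).
  + by apply: measurable_funeM.
  + move=> s _; rewrite -EFinM lee_fin [h * s * v]mulrAC normrM ler_wpM2r //.
    rewrite normrM -[leRHS]mul1r ler_pM //.
      rewrite indicE; case: (boolP (s \in _)) => [|_]; last by rewrite mul0r normr0.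
      rewrite inE /= in_itv /= => /andP[s0 s1]; rewrite mul1r normrX.
      by rewrite exprn_ile1 // ger0_norm; lra.
    rewrite indicE vB mul1r normrX exprS -[leRHS]mulr1 ler_wpM2l //.
    move: vB; rewrite inE /= in_itv /= => /andP[v1 v2].
    by rewrite exprn_ile1 // ler_norml v1.
Qed.

Lemma is_derive1_sum (R : realType) (n : nat) (f : nat -> R -> R) (df : nat -> R) (x : R) :
  (forall i, is_derive x (1 : R) (f i) (df i)) ->
  is_derive x (1 : R) (fun x => \sum_(i < n) f i x) (\sum_(i < n) df i).
Proof.
move=> fd; have := @is_derive_sum R R _ n (fun i => f i) x 1 (fun i => df i) (fun i => fd i).
rewrite (_ : \sum_(i < n) f i = fun x => \sum_(i < n) f i x) //.
by apply/funext => y; rewrite fct_sumE.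
Qed.

Lemma is_derive_scaled_exp (R : realType) (h c x : R) (n : nat) :
  is_derive x (1 : R) (fun v => c * (h * v) ^+ n.+1 / n.+1`!%:R)
    (h * (c * (h * x) ^+ n / n`!%:R)).
Proof.
have d : is_derive x (1 : R) (fun v : R => h * v) h.
  by apply: is_derive_eq (is_deriveZ _ _) _; rewrite -[_ *: _]/(_ * _) mulr1.
have d2 := is_deriveZ (c / n.+1`!%:R) (is_deriveX n.+1 d).
rewrite (_ : (fun v => c * (h * v) ^+ n.+1 / n.+1`!%:R) =
  c / n.+1`!%:R \*: (fun v => h * v) ^+ n.+1); last first.
  by apply/funext => v; rewrite /= exprfctE -[_ *: _]/(_ * _) mulrAC.
apply: is_derive_eq d2 _; rewrite -![_ *: _]/(_ * _) /= factS natrM.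
have N0 : n.+1%:R != 0 :> R by rewrite pnatr_eq0.
have F0 : n`!%:R != 0 :> R by rewrite pnatr_eq0 -lt0n fact_gt0.
move: N0 F0; move: n.+1%:R n`!%:R => a b a0 b0.
by field; rewrite a0 b0.
Qed.

Lemma is_derive_affine_comp (R : realType) (F dF : R -> R) (k h x : R) :
  (forall x : R, is_derive x (1 : R) F (dF x)) ->
  is_derive x (1 : R) (fun v => F (k + h * v)) (h * dF (k + h * x)).
Proof.
move=> FdF.
have d : is_derive x (1 : R) (fun v : R => k + h * v) h.
  apply: is_derive_eq (is_deriveD _ (is_deriveZ _ _)) _.
  by rewrite -[_ *: _]/(_ * _) mulr1 add0r.
have := @is_derive1_comp R F (fun v => k + h * v) x _ _ (FdF _) d.
by rewrite mulrC.
Qed.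

Lemma integral_patch (R : realType) (f : R -> R) (D : set R) :
  measurable D -> mu.-integrable D (EFin \o f) ->
  (\int[@lebesgue_measure R]_x ((f \_ D) x)%:E)%E =
  (\int[mu]_(x in D) f x)%R%:E.
Proof.
move=> mD fi; rewrite /Rintegral fineK; last exact: integrable_fin_num fi.
rewrite [RHS]integral_mkcond; apply: eq_integral => x _.
by rewrite restrict_EFin.
Qed.

Lemma integrable_patch (R : realType) (f : R -> R) (D : set R) :
  measurable D -> mu.-integrable [set: R] (EFin \o (f \_ D)) <->
  mu.-integrable D (EFin \o f).
Proof.
by move=> mD; rewrite -restrict_EFin; split=> [fi|];
  [exact/integrable_mkcond|move/integrable_mkcond; exact].
Qed.

Lemma scaled_argument_in (R : realType) (k h s v : R) : 0 <= h ->
  0 <= s <= 1 -> -1 <= v <= 1 -> k - h <= k + h * s * v <= k + h.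
Proof.
move=> h0 /andP[s0 s1]; rewrite -ler_norml => v1.
rewrite lerD2l lerD2l -ler_norml !normrM (ger0_norm h0) (ger0_norm s0) -mulrA ler_piMr //.
by rewrite mulr_ile1.
Qed.

(** Cutting [g] off outside [[k - h, k + h]] makes it integrable on the whole line without changing
    the kernel, whose arguments stay in that interval. *)
Lemma scaled_kernel_patch (R : realType) (N : nat) (g : R -> R) (k h s v : R) :
  0 <= h -> scaled_kernel N (g \_ `[k - h, k + h]) k h (s, v) =
    if (0 <= s <= 1) && (-1 <= v <= 1) then
      (1 - s) ^+ N * (v ^+ N.+1 * g (k + h * s * v)) else 0.
Proof.
move=> h0; rewrite /scaled_kernel /= !indicE !mem_setE !in_itv /=.
case: ifPn => [/andP[s01 v11]|]; last first.
  by rewrite negb_and => /orP[] /negbTE ->; rewrite ?(mul0r, mulr0).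
rewrite s01 v11 !mul1r patchT ?mulrA // mem_setE in_itv /=.
exact: scaled_argument_in.
Qed.

(** After exchanging the integrals, the inner one over [s] is the Taylor remainder of [d 0] at
    [k + h * v]. Integrating over [v] from -1 to 1 turns it into a difference of values of [F], in
    which the even powers of [h] cancel. *)
Lemma symmetric_taylor (R : realType) (N : nat) (d : nat -> R -> R)
    (F g : R -> R) (k h : R) :
  0 < h ->
  (forall i, (i < N)%N -> forall x : R, is_derive x (1 : R) (d i) (d i.+1 x)) ->
  continuous (d N) -> is_RN_derivative (d N) g ->
  (forall x : R, is_derive x (1 : R) F (d 0%N x)) ->
  let K s := \int[mu]_(v in `[-1, 1]) (v ^+ N.+1 * g (k + h * s * v)) in
  mu.-integrable `[0, 1] (EFin \o (fun s => (1 - s) ^+ N * K s)) /\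
  h ^+ N.+2 / N`!%:R * \int[mu]_(s in `[0, 1]) ((1 - s) ^+ N * K s) =
  F (k + h) - F (k - h) -
  \sum_(i < N.+1) d i k * (1 - (-1) ^+ i.+1) * h ^+ i.+1 / i.+1`!%:R.
Proof.
move=> h0 hd cd hg dF K.
have h0' := ltW h0.
have [gi _] : mu.-integrable `[k - h, k + h] (EFin \o g) /\ True.
  by split=> //; have [] := hg (k - h) (k + h) ltac:(lra).
set g0 := g \_ `[k - h, k + h].
have g0i : mu.-integrable [set: R] (EFin \o g0) by exact/integrable_patch.
have Pi := integrable_scaled_kernel N k h0 g0i.
set P := scaled_kernel N g0 k h in Pi.
have gsi s a b : mu.-integrable `[a, b] (EFin \o (fun v => g (k + s * v))).
  exact: is_RN_derivative_integrable_affine hg.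
have Ki s : mu.-integrable `[-1, 1] (EFin \o (fun v => v ^+ N.+1 * g (k + h * s * v))).
  by apply: continuous_mul_integrable => //; exact: exprn_continuous.
pose T v := \int[mu]_(s in `[0, 1]) ((1 - s) ^+ N * g (k + h * v * s)).
have Ti v : mu.-integrable `[0, 1] (EFin \o (fun s => (1 - s) ^+ N * g (k + h * v * s))).
  by apply: continuous_mul_integrable => //; exact: continuous_onem_exp.
have HA s : (\int[mu]_v (P (s, v))%:E)%E = (((fun s => (1 - s) ^+ N * K s) \_ `[0, 1]) s)%:E.
  rewrite patchE mem_setE in_itv /=; case: ifPn => s01; last first.
    by rewrite integral0_eq // => v _; rewrite /P scaled_kernel_patch // (negbTE s01).
  rewrite -RintegralZl // -integral_patch //; last exact: RintegrableZl.
  apply: eq_integral => v _; rewrite /P scaled_kernel_patch // s01 /=.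
  by rewrite patchE mem_setE in_itv.
have HB v : (\int[mu]_s (P (s, v))%:E)%E = (((fun v => v ^+ N.+1 * T v) \_ `[-1, 1]) v)%:E.
  rewrite patchE mem_setE in_itv /=; case: ifPn => v11; last first.
    by rewrite integral0_eq // => s _; rewrite /P scaled_kernel_patch // (negbTE v11) andbF.
  rewrite -RintegralZl // -integral_patch //; last exact: RintegrableZl.
  apply: eq_integral => s _; rewrite /P scaled_kernel_patch // v11 andbT /=.
  by rewrite patchE mem_setE in_itv /= mulrCA mulrAC.
split.
  (* The function [K] need not be bounded near 0; its weighted integrability is part of Fubini's
     theorem. *)
  apply/integrable_patch => //.
  have := integrable_fubini_F Pi; apply: eq_integrable => // s _.
  by rewrite /fubini_F /= HA.
have -> : \int[mu]_(s in `[0, 1]) ((1 - s) ^+ N * K s) =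
    \int[mu]_(v in `[-1, 1]) (v ^+ N.+1 * T v).
  rewrite Rintegral_mkcond [RHS]Rintegral_mkcond /Rintegral; congr fine.
  under eq_integral do rewrite -HA.
  by rewrite (Fubini Pi); apply: eq_integral => v _; rewrite HB.
(* [q] is the Taylor remainder in closed form and [Q] is a primitive of [h * q], so the integral
   over [v] is an evaluation of [Q]. *)
pose q v := d 0%N (k + h * v) - \sum_(i < N.+1) d i k * (h * v) ^+ i / i`!%:R.
pose Q v := F (k + h * v) - \sum_(i < N.+1) d i k * (h * v) ^+ i.+1 / i.+1`!%:R.
have qE v : h * q v = h ^+ N.+2 / N`!%:R * (v ^+ N.+1 * T v).
  rewrite /q (is_RN_derivative_taylor _ (h * v) hd cd hg) addrC addKr.
  by rewrite -/(T v) exprMn [h ^+ N.+2]exprS; ring.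
have dQ v : is_derive v (1 : R) Q (h * q v).
  rewrite /q mulrBr mulr_sumr; apply: is_deriveB.
    exact: is_derive_affine_comp.
  exact: (@is_derive1_sum R N.+1 (fun i v => d i k * (h * v) ^+ i.+1 / i.+1`!%:R)
    (fun i => h * (d i k * (h * v) ^+ i / i`!%:R)) v
    (fun i => is_derive_scaled_exp h (d i k) v i)).
have cq : continuous (fun v => h * q v).
  have cd0 : continuous (d 0%N).
    by case: (N) hd cd => // N' hd' _; exact: is_derive1_continuous (hd' 0%N _).
  move=> v; apply: cvgM; first exact: cvg_cst.
  apply: cvgB.
    apply: continuous_comp; last exact: cd0.
    by apply: cvgD; [exact: cvg_cst|apply: cvgM; [exact: cvg_cst|exact: cvg_id]].
  apply: cvg_big => [|i _]; first exact: add_continuous.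
  apply: cvgM; last exact: cvg_cst.
  apply: cvgM; first exact: cvg_cst.
  apply: (@continuous_comp _ _ _ (fun v => h * v) (fun w => w ^+ i));
    last exact: exprn_continuous.
  by apply: cvgM; [exact: cvg_cst|exact: cvg_id].
(* Integrability is read off from the continuous function [h * q], of which this is a constant
   multiple. *)
have vTi : mu.-integrable `[-1, 1] (EFin \o (fun v => v ^+ N.+1 * T v)).
  have C0 : h ^+ N.+2 / N`!%:R != 0.
    by rewrite mulf_neq0 ?invr_neq0 ?expf_neq0 ?gt_eqF // ltr0n fact_gt0.
  have : mu.-integrable `[-1, 1] (EFin \o (fun v => (h ^+ N.+2 / N`!%:R)^-1 * (h * q v))).
    by apply: RintegrableZl => //; exact: continuous_itv_integrable.
  by apply: eq_integrable => // v _ /=; rewrite qE mulKf.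
rewrite -RintegralZl //.
under eq_Rintegral do rewrite -qE.
rewrite (Rintegral_derive _ dQ cq); last lra.
rewrite /Q mulr1 mulrN1 -[k - h]/(k + - h).
rewrite (_ : \sum_(i < N.+1) d i k * (1 - (-1) ^+ i.+1) * h ^+ i.+1 / i.+1`!%:R =
  \sum_(i < N.+1) d i k * h ^+ i.+1 / i.+1`!%:R -
  \sum_(i < N.+1) d i k * (- h) ^+ i.+1 / i.+1`!%:R); first ring.
by rewrite -sumrB; apply: eq_bigr => i _; rewrite (exprNn h); ring.
Qed.

(** * Passage to the limit *)

Lemma lebesgue_measure_itv_fin (R : realType) (x y : R) :
  (@lebesgue_measure R `[x, y] < +oo)%E.
Proof.
by rewrite lebesgue_measure_itv /=; case: ifP => _; rewrite ?ltry // -EFinD ltry.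
Qed.

Lemma integrable_cst_finite d (T : measurableType d) (R : realType)
    (nu : {measure set T -> \bar R}) (D : set T) (r : R) :
  measurable D -> (nu D < +oo)%E -> nu.-integrable D (EFin \o cst r).
Proof.
move=> mD Dfin; apply: measurable_bounded_integrable => //.
by exists `|r|; split; [exact: num_real|move=> M rM x _ /=; exact: ltW].
Qed.

Lemma Rintegral_dist_le d (T : measurableType d) (R : realType)
    (nu : {measure set T -> \bar R}) (D : set T) (u v : T -> R) (e : R) :
  measurable D -> (nu D < +oo)%E ->
  nu.-integrable D (EFin \o u) -> nu.-integrable D (EFin \o v) ->
  (forall x, D x -> `|u x - v x| <= e) ->
  `|\int[nu]_(x in D) u x - \int[nu]_(x in D) v x| <= e * fine (nu D).
Proof.
move=> mD Dfin ui vi uv; rewrite -RintegralB // -Rintegral_cst //.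
apply: normr_Rintegral_le => //; first exact: RintegrableB.
exact: integrable_cst_finite.
Qed.

(** The limit is measurable as a pointwise limit, and a single [u n] within distance 1 dominates it
    by [|u n| + 1]. *)
Lemma integrable_uniform_limit d (T : measurableType d) (R : realType)
    (nu : {measure set T -> \bar R}) (D : set T) (u : nat -> T -> R) (v : T -> R) :
  measurable D -> (nu D < +oo)%E -> (forall n, nu.-integrable D (EFin \o u n)) ->
  (forall e : R, 0 < e -> \forall n \near \oo, forall x, D x -> `|u n x - v x| <= e) ->
  nu.-integrable D (EFin \o v).
Proof.
move=> mD Dfin ui uv.
have mv : measurable_fun D v.
  apply: (@measurable_fun_cvg _ _ _ _ u) => [n|x Dx].
    by apply/measurable_EFinP; exact: (measurable_int _ (ui n)).
  apply/cvgrPdist_le => e e0; have := uv _ e0; apply: filterS => n hn.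
  by rewrite distrC; exact: hn.
have [n _ /(_ n (leqnn n)) hn] := uv 1 ltr01.
have : nu.-integrable D (EFin \o (fun x => `|u n x| + 1)).
  apply: RintegrableD => //; first exact: integrable_norm.
  exact: integrable_cst_finite.
apply: le_integrable => // [|x Dx]; first exact/measurable_EFinP.
rewrite lee_fin /= [leRHS]ger0_norm ?addr_ge0 //.
have := hn x Dx; have := ler_normB (u n x) (u n x - v x).
by rewrite opprB addrCA subrr addr0; lra.
Qed.

Lemma Rintegral_uniform_cvg d (T : measurableType d) (R : realType)
    (nu : {measure set T -> \bar R}) (D : set T) (u : nat -> T -> R) (v : T -> R) :
  measurable D -> (nu D < +oo)%E -> (forall n, nu.-integrable D (EFin \o u n)) ->
  (forall e : R, 0 < e -> \forall n \near \oo, forall x, D x -> `|u n x - v x| <= e) ->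
  \int[nu]_(x in D) u n x @[n --> \oo] --> \int[nu]_(x in D) v x.
Proof.
move=> mD Dfin ui uv.
have vi := integrable_uniform_limit mD Dfin ui uv.
(* The added 1 keeps the divisor positive when [D] is null. *)
have D1 : 0 < fine (nu D) + 1 by rewrite ltr_wpDl // fine_ge0.
apply/cvgrPdist_le => e e0.
have := uv (e / (fine (nu D) + 1)) (divr_gt0 e0 D1).
apply: filterS => n hn; rewrite distrC.
apply: le_trans (Rintegral_dist_le mD Dfin (ui n) vi hn) _.
rewrite mulrAC ler_pdivrMr // ler_wpM2l ?(ltW e0) //; lra.
Qed.

Definition dilated_moment (R : realType) (m : nat) (g : R -> R) (j : nat) (k s : R) : R :=
  \int[mu]_(v in `[-1, 1]) (v ^+ (2 * m) * g (k + j%:R * s * v / 2)).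

(** Unlike in [R_infty], the sum over [j] stands outside the integrals, because Taylor's formula is
    applied to one [j] at a time. *)
Definition step_remainder (R : realType) (m : nat) (g : R -> R) (k : R) : R :=
  (((2 * m).-1)`!%:R * 2 ^+ (2 * m).+1)^-1 *
  \sum_(1 <= j < m.+1) gamma_coef R m j * j%:R ^+ (2 * m).+1 *
    \int[mu]_(s in `[0, 1]) ((1 - s) ^+ (2 * m).-1 * dilated_moment m g j k s).

Lemma Cminus_is_derive (R : realType) (n : nat) (f : R -> R) (i : nat) (x : R) :
  Cminus n f -> (i.+1 < n)%N ->
  is_derive x (1 : R) (derive1n i f) (derive1n i.+1 f x).
Proof.
move=> [df _ _] /df /(_ x) /derivableP.
by rewrite derive1nS derive1E.
Qed.

(** This is [symmetric_taylor] with half-width [j / 2]; the power of 2 in the normalisation comes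
    from [(j / 2) ^+ (2 * m).+1]. *)
Lemma dilated_moment_taylor (R : realType) (m : nat) (f F g : R -> R) (j : nat) (k : R) :
  (0 < m)%N -> (0 < j)%N -> Cminus (2 * m) f ->
  is_RN_derivative (derive1n (2 * m).-1 f) g ->
  (forall x : R, is_derive x (1 : R) F (f x)) ->
  mu.-integrable `[0, 1]
    (EFin \o (fun s => (1 - s) ^+ (2 * m).-1 * dilated_moment m g j k s)) /\
  (((2 * m).-1)`!%:R * 2 ^+ (2 * m).+1)^-1 * (j%:R ^+ (2 * m).+1 *
    \int[mu]_(s in `[0, 1]) ((1 - s) ^+ (2 * m).-1 * dilated_moment m g j k s)) =
  F (k + j%:R / 2) - F (k - j%:R / 2) -
  \sum_(i < 2 * m) derive1n i f k * (1 - (-1) ^+ i.+1) * (j%:R / 2) ^+ i.+1 / i.+1`!%:R.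
Proof.
move=> m0 j0 hf hg dF.
have [N NE] : exists N, (2 * m)%N = N.+1 by exists (2 * m).-1; lia.
have h0 : 0 < j%:R / 2 :> R by rewrite divr_gt0 // ltr0n.
have mE s : dilated_moment m g j k s =
    \int[mu]_(v in `[-1, 1]) (v ^+ N.+1 * g (k + j%:R / 2 * s * v)).
  rewrite /dilated_moment NE; apply: eq_Rintegral => v _; congr (_ * g (k + _)).
  by ring.
have hd i : (i < N)%N -> forall x : R,
    is_derive x (1 : R) (derive1n i f) (derive1n i.+1 f x).
  by move=> iN x; apply: Cminus_is_derive hf _; lia.
have cd : continuous (derive1n N f) by case: hf => _ + _; apply; lia.
rewrite NE /= in hg *.
have [i1 E] := symmetric_taylor k h0 hd cd hg dF.
rewrite -E; split.
  by apply: eq_integrable i1 => // s _ /=; rewrite mE.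
under [in LHS]eq_Rintegral do rewrite mE.
by rewrite expr_div_n mulrA invfM; congr (_ * _); ring.
Qed.

Lemma gamma_coef_taylor (R : realType) (m : nat) (d : nat -> R) :
  (0 < m)%N ->
  \sum_(1 <= j < m.+1) gamma_coef R m j *
    \sum_(i < 2 * m) d i * (1 - (-1) ^+ i.+1) * (j%:R / 2) ^+ i.+1 / i.+1`!%:R
  = d 0%N.
Proof.
move=> m0; under eq_bigr do rewrite mulr_sumr.
rewrite exchange_big /= (eq_bigr (fun i : 'I_(2 * m) =>
  d i * (1 - (-1) ^+ i.+1) / i.+1`!%:R / 2 ^+ i.+1 *
  \sum_(1 <= j < m.+1) gamma_coef R m j * j%:R ^+ i.+1)); last first.
  by move=> i _; rewrite mulr_sumr; apply: eq_bigr => j _; rewrite expr_div_n; ring.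
have m2 : (0 < 2 * m)%N by lia.
(* Index 0 contributes [d 0] times [(1 - (-1)) / 2 = 1]. Odd indices vanish by the sign factor,
   positive even ones by the moments. *)
rewrite (bigD1 (Ordinal m2)) //= [X in _ + X]big1 ?addr0 => [|i i0].
  by rewrite gamma_coef_moment // eqxx mulr1 (_ : 1`! = 1%N) // !expr1; field.
have {}i0 : (i : nat) != 0%N by apply: contra i0 => /eqP h; apply/eqP/val_inj.
have [oi|ei] := boolP (odd i).
  by rewrite -signr_odd /= oi /= subrr mulr0 !mul0r.
by rewrite gamma_coef_moment // (negbTE i0) mulr0.
Qed.

Lemma G_sum_step (R : realType) (m : nat) (f F g : R -> R) (n : nat) :
  (0 < m)%N -> Cminus (2 * m) f ->
  is_RN_derivative (derive1n (2 * m).-1 f) g ->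
  (forall x : R, is_derive x (1 : R) F (f x)) ->
  step_remainder m g n%:R = G_sum m F n.+1 - G_sum m F n - f n%:R.
Proof.
move=> m0 hf hg dF.
rewrite /step_remainder G_sumS mulr_sumr.
rewrite -[f n%:R](gamma_coef_taylor (fun i => derive1n i f n%:R) m0) -sumrB.
rewrite big_nat [RHS]big_nat; apply: eq_bigr => j /andP[j0 _].
have [_ E] := dilated_moment_taylor n%:R m0 j0 hf hg dF.
by rewrite -mulrBr -E; ring.
Qed.

(** Unfolds the uniform topology into the epsilon form that the estimates below use. *)
Lemma uniform_cvg_dist (R : realType) (D : set R) (u : nat -> R -> R) (S : R -> R) :
  {uniform D, u @ \oo --> S} ->
  forall e : R, 0 < e -> \forall n \near \oo, forall x, D x -> `|u n x - S x| <= e.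
Proof.
move=> uS e e0.
have : nbhs (S : {uniform` D -> R}) [set h : R -> R | forall x, D x -> ball (S x) e (h x)].
  apply/uniform_nbhs; exists [set xy : R * R | ball xy.1 e xy.2]; split => //.
  exact: (entourage_ball _ (PosNum e0)).
move=> /uS [M _ hM]; exists M => // n /hM /= hn x /hn.
by rewrite -ball_normE /= distrC => /ltW.
Qed.

Lemma Rintegrable_sum d (T : measurableType d) (R : realType)
    (nu : {measure set T -> \bar R}) (D : set T) (I : eqType) (r : seq I)
    (f : I -> T -> R) :
  measurable D -> (forall i, i \in r -> nu.-integrable D (EFin \o f i)) ->
  nu.-integrable D (EFin \o (fun x => \sum_(i <- r) f i x)).
Proof.
move=> mD; elim: r => [|i r IH] fi.
  apply: eq_integrable (integrable0 nu D) => // x _ /=.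
  by rewrite big_nil.
have : nu.-integrable D (EFin \o (fun x => f i x + \sum_(j <- r) f j x)).
  apply: RintegrableD => //; first by apply: fi; rewrite mem_head.
  by apply: IH => j jr; apply: fi; rewrite inE jr orbT.
by apply: eq_integrable => // x _ /=; rewrite big_cons.
Qed.

Lemma Rintegral_sum d (T : measurableType d) (R : realType)
    (nu : {measure set T -> \bar R}) (D : set T) (I : eqType) (r : seq I)
    (f : I -> T -> R) :
  measurable D -> (forall i, i \in r -> nu.-integrable D (EFin \o f i)) ->
  \int[nu]_(x in D) (\sum_(i <- r) f i x) = \sum_(i <- r) \int[nu]_(x in D) f i x.
Proof.
move=> mD; elim: r => [|i r IH] fi.
  rewrite big_nil; under eq_Rintegral do rewrite big_nil.
  by rewrite Rintegral_cst // mul0r.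
have fr j : j \in r -> nu.-integrable D (EFin \o f j).
  by move=> jr; apply: fi; rewrite inE jr orbT.
rewrite big_cons -IH // -RintegralD //; last 2 first.
- by apply: fi; rewrite mem_head.
- exact: Rintegrable_sum.
by apply: eq_Rintegral => x _; rewrite big_cons.
Qed.

Lemma shifted_series_uniform (R : realType) (D : set R) (g S : R -> R) (c : nat) :
  (forall e : R, 0 < e -> \forall n \near \oo, forall x, D x ->
    `|\sum_(0 <= k < n) g (k%:R + x) - S x| <= e) ->
  forall e : R, 0 < e -> \forall n \near \oo, forall x, D x ->
    `|\sum_(0 <= k < n) g (k%:R + x + c%:R) -
      limn (series (fun k : nat => g (k%:R + x + c%:R)))| <= e.
Proof.
(* [n] terms of the shifted series are [n + c] terms of the original one without the first [c]. The
   value [limn] is identified with [T] only on [D], where convergence is known. *)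
move=> gS; pose T x := S x - \sum_(0 <= k < c) g (k%:R + x).
have wT (e : R) : 0 < e -> \forall n \near \oo, forall x, D x ->
    `|\sum_(0 <= k < n) g (k%:R + x + c%:R) - T x| <= e.
  move=> e0; have [M _ hM] := gS e e0; exists M => // n /= Mn x Dx.
  have := hM (n + c)%N (leq_trans Mn (leq_addr _ _)) x Dx.
  rewrite (@big_cat_nat _ _ _ c) ?leq_addl //= -{2}[c]add0n big_addn addnK.
  under [X in _ + X - _]eq_bigr do rewrite natrD addrAC.
  by rewrite /T opprB addrCA addrA.
have WT x : D x -> limn (series (fun k : nat => g (k%:R + x + c%:R))) = T x.
  move=> Dx; apply/cvg_lim => //; apply/cvgrPdist_le => e e0.
  by apply: filterS (wT e e0) => n hn; rewrite distrC; exact: hn.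
by move=> e e0; apply: filterS (wT e e0) => n hn x Dx; rewrite WT //; exact: hn.
Qed.

(** Uniform closeness of the partial sums survives the finite sum over [j], the bounded weights and
    both integrations over bounded intervals. It also makes the limiting integrands integrable. *)
Lemma step_remainder_cvg (R : realType) (m : nat) (g S : R -> R) (c : nat) :
  (0 < m)%N ->
  (forall k y : R, mu.-integrable `[-1, 1] (EFin \o (fun v => g (k + y * v)))) ->
  (forall j (k : R), (0 < j)%N -> mu.-integrable `[0, 1]
    (EFin \o (fun s => (1 - s) ^+ (2 * m).-1 * dilated_moment m g j k s))) ->
  (forall e : R, 0 < e -> \forall n \near \oo, forall x, `[- (m%:R / 2), m%:R / 2]%classic x ->
    `|\sum_(0 <= k < n) g (k%:R + x) - S x| <= e) ->
  \sum_(0 <= k < n) step_remainder m g (k + c)%:R @[n --> \oo] -->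
    R_infty m (g \o shift c%:R).
Proof.
move=> m0 gi di gS; set N := (2 * m).-1 in di *.
pose a j : R := gamma_coef R m j * j%:R ^+ (2 * m).+1.
pose w n x := \sum_(0 <= k < n) g (k%:R + x + c%:R).
pose W x := limn (series (fun k : nat => g (k%:R + x + c%:R))).
have wW := shifted_series_uniform c gS.
pose u n s v := v ^+ (2 * m) * \sum_(1 <= j < m.+1) a j * w n (j%:R * s * v / 2).
pose u' s v := v ^+ (2 * m) * \sum_(1 <= j < m.+1) a j * W (j%:R * s * v / 2).
pose A n s := \int[mu]_(v in `[-1, 1]) u n s v.
pose A' s := \int[mu]_(v in `[-1, 1]) u' s v.
pose f3 (s v : R) (p : nat * nat) :=
  a p.1 * (v ^+ (2 * m) * g ((p.2 + c)%:R + p.1%:R * s * v / 2)).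
(* The double sum is flattened to one list of pairs, so that linearity of the integral is used once
   per integral. [rP] keeps [j] positive, as [di] requires. *)
pose r n := [seq (j, k) | j <- index_iota 1 m.+1, k <- index_iota 0 n].
have rP n p : p \in r n -> (0 < p.1)%N.
  by case/allpairsP => -[j k] /= [+ _ ->]; rewrite mem_index_iota => /andP[].
have uE n s v : u n s v = \sum_(p <- r n) f3 s v p.
  rewrite /u mulr_sumr /r big_allpairs_dep /=; apply: eq_bigr => j _.
  rewrite /w mulr_sumr mulr_sumr; apply: eq_bigr => k _.
  by rewrite /f3 /= mulrCA natrD addrAC.
have gi3 s p : mu.-integrable `[-1, 1]
    (EFin \o (fun v => v ^+ (2 * m) * g ((p.2 + c)%:R + p.1%:R * s * v / 2))).
  apply: continuous_mul_integrable; first exact: exprn_continuous.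
  apply: eq_integrable (gi (p.2 + c)%:R (p.1%:R * s / 2)) => // v _ /=.
  by congr ((g (_ + _))%:E); ring.
have fi3 s p : mu.-integrable `[-1, 1] (EFin \o (fun v => f3 s v p)) by exact: RintegrableZl.
have ui n s : mu.-integrable `[-1, 1] (EFin \o u n s).
  apply: eq_integrable (Rintegrable_sum (r := r n) _ (fun p _ => fi3 s p)) => //.
  by move=> v _ /=; rewrite uE.
have AE n s : A n s = \sum_(p <- r n) a p.1 * dilated_moment m g p.1 (p.2 + c)%:R s.
  rewrite /A; under eq_Rintegral do rewrite uE.
  rewrite Rintegral_sum //; apply: eq_bigr => p _.
  by rewrite RintegralZl.
pose L := \sum_(1 <= j < m.+1) `|a j|.
have L0 : 0 <= L by exact: sumr_ge0.
have uu' (e : R) : 0 < e -> \forall n \near \oo, forall s, `[(0 : R), 1]%classic s ->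
    forall v, `[(-1 : R), 1]%classic v -> `|u n s v - u' s v| <= e.
  move=> e0; have e1 : 0 < e / (L + 1) by rewrite divr_gt0 // ltr_wpDl.
  apply: filterS (wW _ e1) => n hn s s01 v v11.
  rewrite /u /u' -mulrBr -sumrB normrM.
  apply: (@le_trans _ _ (1 * (L * (e / (L + 1))))); last first.
    rewrite mul1r mulrA ler_pdivrMr ?ltr_wpDl // mulrC ler_wpM2l ?(ltW e0) //; lra.
  move: s01 v11; rewrite /= !in_itv /= => s01 v11.
  apply: ler_pM => //.
    by rewrite normrX exprn_ile1 // ler_norml.
  rewrite /L mulr_suml; apply: le_trans (ler_norm_sum _ _ _) _.
  rewrite big_nat [leRHS]big_nat; apply: ler_sum => j /andP[j0 jm].
  (* The shift [j * s * v / 2] has absolute value at most [j / 2], hence at most [m / 2]: this fixes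
     the interval of uniform convergence. *)
  rewrite -mulrBr normrM ler_wpM2l //; apply: hn; rewrite /= in_itv /=.
  have jh0 : 0 <= j%:R / 2 :> R by rewrite divr_ge0.
  have := @scaled_argument_in _ 0 _ s v jh0 s01 v11; rewrite !add0r.
  rewrite (_ : j%:R / 2 * s * v = j%:R * s * v / 2); last by ring.
  have : j%:R <= m%:R :> R by rewrite ler_nat -ltnS.
  by move=> jm' /andP[? ?]; apply/andP; split; lra.
have u'i s : `[(0 : R), 1]%classic s -> mu.-integrable `[-1, 1] (EFin \o u' s).
  move=> s01; apply: (@integrable_uniform_limit _ (measurableTypeR R) R lebesgue_measure _
    (fun n => u n s) (u' s));
    [by []|exact: lebesgue_measure_itv_fin|by move=> n; exact: ui|].
  by move=> e /uu'; apply: filterS => n; exact.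
pose U n s := (1 - s) ^+ N * A n s.
have I1 : fine (lebesgue_measure `[(-1 : R), 1]%classic) = 2 :> R.
  by rewrite lebesgue_measure_itv /= lte_fin gtrN // -EFinD /=; lra.
have UU' (e : R) : 0 < e -> \forall n \near \oo, forall s, `[(0 : R), 1]%classic s ->
    `|U n s - (1 - s) ^+ N * A' s| <= e.
  move=> e0; have e2 : 0 < e / 2 by rewrite divr_gt0.
  apply: filterS (uu' _ e2) => n hn s s01.
  rewrite /U -mulrBr normrM -[leRHS]mul1r ler_pM //.
    move: s01; rewrite /= in_itv /= => /andP[s0 s1].
    by rewrite normrX exprn_ile1 // ger0_norm; lra.
  (* The 2 is the length of [[-1, 1]], which compensates for the choice of [e / 2]. *)
  rewrite -[leRHS](@divfK _ 2) // -{2}I1.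
  apply: Rintegral_dist_le; first by [].
  - exact: lebesgue_measure_itv_fin.
  - exact: ui.
  - exact: u'i.
  - exact: hn.
have UE n s : U n s = \sum_(p <- r n)
    a p.1 * ((1 - s) ^+ N * dilated_moment m g p.1 (p.2 + c)%:R s).
  by rewrite /U AE mulr_sumr; apply: eq_bigr => p _; rewrite mulrCA.
have adi n p : p \in r n -> mu.-integrable `[0, 1]
    (EFin \o (fun s => a p.1 * ((1 - s) ^+ N * dilated_moment m g p.1 (p.2 + c)%:R s))).
  by move=> /rP p0; apply: RintegrableZl => //; exact: di.
have Ui n : mu.-integrable `[0, 1] (EFin \o U n).
  by apply: eq_integrable (Rintegrable_sum (r := r n) _ (adi n)) => // s _ /=; rewrite UE.
have cvgU : \int[mu]_(s in `[0, 1]) U n s @[n --> \oo] -->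
    \int[mu]_(s in `[0, 1]) ((1 - s) ^+ N * A' s).
  apply: Rintegral_uniform_cvg; first by [].
  - exact: lebesgue_measure_itv_fin.
  - exact: Ui.
  - exact: UU'.
pose C : R := (N`!%:R * 2 ^+ (2 * m).+1)^-1.
(* Shifting [g] by [c] gives the [+ c%:R] in [W], so both sides are convertible. *)
have -> : R_infty m (g \o shift c%:R) =
    C * \int[mu]_(s in `[0, 1]) ((1 - s) ^+ N * A' s) by [].
have -> : (fun n => \sum_(0 <= k < n) step_remainder m g (k + c)%:R) =
    (fun n => C * \int[mu]_(s in `[0, 1]) U n s).
  apply/funext => n; under eq_Rintegral do rewrite UE.
  rewrite Rintegral_sum //; last exact: adi.
  rewrite /step_remainder -mulr_sumr; congr (_ * _).
  rewrite /r big_allpairs_dep /= [RHS]exchange_big /=.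
  apply: eq_bigr => k _; rewrite big_nat [RHS]big_nat; apply: eq_bigr => j /andP[j0 _].
  by rewrite [RHS]RintegralZl //; exact: di.
exact: (cvgM (cvg_cst C) cvgU).
Qed.

(** * Comparison of the two sums G *)

(** Since [y * s >= - |y|] on [[0, 1]], the argument of [H] tends to infinity uniformly in [s]. *)
Lemma Rintegral_vanish_at_infinity (R : realType) (H : R -> R) (N : nat) (y : R) :
  continuous H -> H x @[x --> +oo] --> (0 : R) ->
  \int[mu]_(s in `[0, 1]) ((1 - s) ^+ N * H (n%:R - 1 / 2 + y * s)) @[n --> \oo] --> (0 : R).
Proof.
move=> cH H0.
rewrite [X in _ --> X](_ : _ = \int[mu]_(s in `[(0 : R), 1]) (0 : R)); last first.
  by rewrite Rintegral_itv_cst // mul0r.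
apply: (@Rintegral_uniform_cvg _ (measurableTypeR R) R lebesgue_measure _
  (fun n s => (1 - s) ^+ N * H (n%:R - 1 / 2 + y * s)) (fun=> 0)).
- by [].
- exact: lebesgue_measure_itv_fin.
- move=> n; apply: continuous_mul_integrable; first exact: continuous_onem_exp.
  apply: continuous_itv_integrable => s; apply: continuous_comp; last exact: cH.
  by apply: cvgD; [exact: cvg_cst|apply: cvgM; [exact: cvg_cst|exact: cvg_id]].
move=> e e0; have [A [_ hA]] := (cvgrPdist_le _ _).1 H0 e e0.
near=> n => s /=; rewrite in_itv /= => /andP[s0 s1].
rewrite subr0 normrM -[leRHS]mul1r ler_pM //.
  by rewrite normrX exprn_ile1 // ger0_norm; lra.
rewrite -normrN -sub0r; apply: hA.
have ys : - `|y| <= y * s.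
  have : `|y * s| <= `|y| by rewrite normrM ler_piMr // ger0_norm.
  by rewrite ler_norml => /andP[].
suff : A + `|y| + 1 / 2 < n%:R by lra.
by near: n; exact: nbhs_infty_gtr.
Unshelve. all: by end_near. Qed.

(** Both sums are extended by zero coefficients up to [m], and their nodes are recentred at
    [n - 1/2], about which they are symmetric for every [j]. *)
Lemma G_sum_diff (R : realType) (m0 m : nat) (F : R -> R) (n : nat) :
  (m0 <= m)%N ->
  G_sum m F n - G_sum m0 F n = \sum_(1 <= j < m.+1)
    (gamma_coef R m j - gamma_coef R m0 j) *
    \sum_(0 <= i < j) F (n%:R - 1 / 2 + ((j%:R - 1) / 2 - i%:R)).
Proof.
move=> m0m.
have GE r : (r <= m)%N -> G_sum r F n = \sum_(1 <= j < m.+1) gamma_coef R r j *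
    \sum_(0 <= i < j) F (n%:R - 1 / 2 + ((j%:R - 1) / 2 - i%:R)).
  move=> rm; rewrite [RHS](@big_cat_nat _ _ _ r.+1) //=.
  rewrite [X in _ = _ + X]big1_seq ?addr0 => [|j]; last first.
    by rewrite mem_index_iota => /= /andP[rj _]; rewrite gamma_coef_eq0 ?mul0r.
  apply: eq_bigr => j _; congr (_ * _); apply: eq_bigr => i _; congr F.
  by field.
by rewrite !GE // -sumrB; apply: eq_bigr => j _; rewrite -mulrBl.
Qed.

Lemma G_sum_diff_cvg (R : realType) (m0 m : nat) (f F : R -> R) :
  (0 < m0)%N -> (m0 <= m)%N -> Cminus (2 * m) f ->
  (derive1n (2 * m0).-1 f) x @[x --> +oo] --> (0 : R) ->
  (forall x : R, is_derive x (1 : R) F (f x)) ->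
  (G_sum m F n - G_sum m0 F n) @[n --> \oo] --> (0 : R).
Proof.
move=> m00 m0m hf H0 dF.
have [N NE] : exists N, (2 * m0)%N = N.+1 by exists (2 * m0).-1; lia.
rewrite NE /= in H0.
(* The derivatives of [F] rather than of [f]: the index is shifted by one, so order [2 * m0] of [F]
   is [f^(2 m0 - 1)], which is still continuous. *)
pose d i : R -> R := if i is i'.+1 then derive1n i' f else F.
have dd i : (i < N.+1)%N -> forall x : R, is_derive x (1 : R) (d i) (d i.+1 x).
  by case: i => [_ //|i iN x]; apply: Cminus_is_derive hf _; lia.
have ddN i : (i < N)%N -> forall x : R, is_derive x (1 : R) (d i) (d i.+1 x).
  by move=> iN; apply: dd; exact: ltnW.
have cH : continuous (derive1n N f) by case: hf => _ + _; apply; lia.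
have dN := dd N (ltnSn N).
have taylor x y : F (x + y) = \sum_(l < N.+1) d l x * y ^+ l / l`!%:R +
    y ^+ N.+1 / N`!%:R * \int[mu]_(s in `[0, 1]) ((1 - s) ^+ N * derive1n N f (x + y * s)).
  exact: (is_RN_derivative_taylor x y ddN (is_derive1_continuous dN)
    (is_RN_derivative_C1 dN cH)).
pose D j := gamma_coef R m j - gamma_coef R m0 j.
pose y j i : R := (j%:R - 1) / 2 - i%:R.
pose I n j i := y j i ^+ N.+1 / N`!%:R *
  \int[mu]_(s in `[0, 1]) ((1 - s) ^+ N * derive1n N f (n%:R - 1 / 2 + y j i * s)).
(* Both families have the same moments in this range, so those of the difference [D] vanish. *)
have DM b : ~~ odd b -> (b < 2 * m0)%N ->
    \sum_(1 <= j < m.+1) D j * j%:R ^+ b.+1 = 0.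
  move=> eb bm; rewrite /D; under eq_bigr do rewrite mulrBl.
  rewrite sumrB gamma_coef_moment //; last lia.
  rewrite (@big_cat_nat _ _ _ m0.+1) //= gamma_coef_moment //.
  rewrite big1_seq ?addr0 ?subrr // => j.
  by rewrite mem_index_iota => /= /andP[mj _]; rewrite gamma_coef_eq0 ?mul0r.
have GI n : G_sum m F n - G_sum m0 F n = \sum_(1 <= j < m.+1) D j * \sum_(0 <= i < j) I n j i.
  rewrite G_sum_diff //; set x := n%:R - 1 / 2.
  (* [P] collects the Taylor polynomials. Their degree is below [2 * m0], so the weights [D]
     annihilate them and only the remainders [I] are left. *)
  pose P := \sum_(1 <= j < m.+1) D j * \sum_(0 <= i < j)
    \sum_(l < N.+1) d l x * y j i ^+ l / l`!%:R.
  have P0 : P = 0.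
    rewrite /P.
    rewrite (eq_bigr (fun j => \sum_(l < N.+1) d l x / l`!%:R *
        (D j * \sum_(0 <= i < j) y j i ^+ l))) => [|j _]; last first.
      rewrite exchange_big /= mulr_sumr; apply: eq_bigr => l _.
      by rewrite !mulr_sumr; apply: eq_bigr => i _; ring.
    rewrite exchange_big big1 // => l _.
    by rewrite -mulr_sumr (weighted_centred_power_sum DM) ?mulr0 // NE.
  rewrite -[RHS]add0r -[X in X + _]P0 -big_split; apply: eq_bigr => j _.
  rewrite /= -mulrDr -big_split /=.
  by congr (_ * _); apply: eq_bigr => i _; rewrite taylor.
have I0 j i : I n j i @[n --> \oo] --> (0 : R).
  rewrite [X in _ --> X](_ : _ = y j i ^+ N.+1 / N`!%:R * 0); last by rewrite mulr0.
  by apply: cvgM; [exact: cvg_cst|exact: Rintegral_vanish_at_infinity].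
rewrite (_ : (fun n => _) = fun n =>
  \sum_(1 <= j < m.+1) D j * \sum_(0 <= i < j) I n j i); last exact/funext.
rewrite [X in _ --> X](_ : _ = \sum_(1 <= j < m.+1) D j * \sum_(0 <= i < j) 0); last first.
  by rewrite big1 // => j _; rewrite big1 ?mulr0.
apply: cvg_big => [|j _]; first exact: add_continuous.
apply: cvgM; first exact: cvg_cst.
by apply: cvg_big => [|i _]; first exact: add_continuous.
Qed.

(** * Corrected partial sums and the conclusion *)

(** Summing [G_sum_step] from [c] to [n + c] telescopes; [n] enters the right-hand side only through
    the remainders. *)
Lemma partial_sum_G_sum (R : realType) (m : nat) (f F g : R -> R) (c n : nat) :
  (0 < m)%N -> Cminus (2 * m) f ->
  is_RN_derivative (derive1n (2 * m).-1 f) g ->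
  (forall x : R, is_derive x (1 : R) F (f x)) ->
  \sum_(0 <= k < n + c) f k%:R - G_sum m F (n + c) =
  \sum_(0 <= k < c) f k%:R - G_sum m F c -
  \sum_(0 <= k < n) step_remainder m g (k + c)%:R.
Proof.
move=> m0 hf hg dF; elim: n => [|n IH]; first by rewrite [X in _ = _ - X]big_geq // subr0.
rewrite addSn big_nat_recr //= [X in _ = _ - X]big_nat_recr //= (G_sum_step _ m0 hf hg dF).
by rewrite opprD addrA -IH; ring.
Qed.

Theorem corollary5p6 (R : realType) (m0 m : nat)
    (hm0 : (0 < m0)%N) (hm : (m0 <= m)%N)
    (f : R -> R) (hf : Cminus (2 * m) f)
    (f2m : R -> R) (hf2m : is_RN_derivative (derive1n (2 * m).-1 f) f2m)
    (hlim : (derive1n (2 * m0).-1 f) x @[x --> +oo] --> (0 : R))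
    (hunif : exists S : R -> R,
        {uniform `[- (m%:R / 2), m%:R / 2],
          (fun (n : nat) (w : R) => \sum_(0 <= k < n) f2m (k%:R + w)) @ \oo
            --> S})
    (F : R -> R) (hF : forall x : R, is_derive x (1 : R) F (f x))
    (c : nat) :
  cvgn (alt_seq m0 f F) /\
  alt_sum m0 f F =
    \sum_(0 <= k < c) f k%:R - G_sum m F c - R_infty m (f2m \o shift c%:R).
Proof.
have m_gt0 : (0 < m)%N by exact: leq_trans hm.
have [S /uniform_cvg_dist fS] := hunif.
set l := RHS.
(* Convergence to [l] gives both claims; an equation for [limn] alone would not show that the limit
   exists. *)
suff cl : alt_seq m0 f F @ \oo --> l.
  by split; [apply/cvg_ex; exists l|apply/cvg_lim].
have rem : \sum_(0 <= k < n) step_remainder m f2m (k + c)%:R @[n --> \oo] -->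
    R_infty m (f2m \o shift c%:R).
  apply: step_remainder_cvg fS => // [k y|j k j0].
    exact: is_RN_derivative_integrable_affine hf2m.
  by have [] := dilated_moment_taylor k m_gt0 j0 hf hf2m hF.
have main : (\sum_(0 <= k < n) f k%:R - G_sum m F n) @[n --> \oo] --> l.
  rewrite -(cvg_shiftn c) /=.
  rewrite (_ : (fun n => _) = fun n => \sum_(0 <= k < c) f k%:R - G_sum m F c -
      \sum_(0 <= k < n) step_remainder m f2m (k + c)%:R); last first.
    by apply/funext => n; exact: partial_sum_G_sum.
  by apply: cvgB; first exact: cvg_cst.
(* Passing from order [m] to order [m0] adds a difference of two [G_sum] that tends to 0. *)
rewrite -[l]addr0 (_ : alt_seq m0 f F = fun n =>
    (\sum_(0 <= k < n) f k%:R - G_sum m F n) + (G_sum m F n - G_sum m0 F n)).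
  by apply: cvgD => //; exact: G_sum_diff_cvg hlim hF.
by apply/funext => n; rewrite /alt_seq addrA subrK.
Qed.
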